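(* Let $A$ be a finite-dimensional real alternative $*$-algebra, let $G$ be a symmetric domain in $\mathbb{C}$ with associated axially symmetric domain $\Omega_G\subset Q_A$, and let $D$ be an adapted subset of $\Omega_G$. Then there exist a slice regular function $f$ on $\Omega_G$, with associated stem function $F:G\to A_{\mathbb{C}}$, and a point $p\in G$ such that $$D=\{q\in\Omega_G: f(q)=0\}$$ and $F(p)\in A_{\mathbb{C}}^*$, i.e. $F(p)$ is invertible in $A_{\mathbb{C}}$.
   Context: A finite-dimensional alternative real $*$-algebra $A$ is a finite-dimensional unital real algebra ($\mathbb{R}=\mathbb{R}\cdot 1\subset A$) with $x(xy)=(xx)y$ and $x(yy)=(xy)y$ for all $x,y\in A$, equipped with a real-linear involution $x\mapsto x^c$ satisfying $(xy)^c=y^cx^c$ and fixing $\mathbb{R}$ pointwise. The pseudosphere is $\mathbb{S}_A=\{w\in A: w+w^c=0,\ ww^c=1\}$ (so $w^2=-1$ for $w\in\mathbb{S}_A$); the quadratic cone is $Q_A=\mathbb{R}\cup\{w\in A: w+w^c\in\mathbb{R},\ ww^c\in\mathbb{R},\ 4ww^c>(w+w^c)^2\}$, equivalently $Q_A=\mathbb{R}\cup\{x+yI:x,y\in\mathbb{R},I\in\mathbb{S}_A\}$. A symmetric domain in $\mathbb{C}$ is a (non-empty) open subset $G$ with $z\in G\iff\bar z\in G$ whose quotient by the relation $z\sim w\iff(z=w\text{ or }z=\bar w)$ is connected. Its associated axially symmetric domain is $\Omega_G=\{x+yI: x+yi\in G,\ x,y\in\mathbb{R},\ I\in\mathbb{S}_A\}\subset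 Q_A$. Put $G^+=\{z\in G:\operatorname{Im}z\ge0\}$ and $\pi:\Omega_G\to G^+$, $\pi(x+yI)=x+|y|i$. A subset $D\subset\Omega_G$ is adapted if (1) $\pi(D)$ is discrete in $G^+$ (i.e. has no accumulation point in $G^+$), and (2) for every $x,y\in\mathbb{R}$ either $x+y\mathbb{S}_A\subset D$ or $(x+y\mathbb{S}_A)\cap D$ contains at most one element. Let $A_{\mathbb{C}}=A\otimes_{\mathbb{R}}\mathbb{C}$, whose elements are written $a+ib$ with $a,b\in A$ ($i$ central), with complex conjugation $\overline{a+ib}=a-ib$; $A_{\mathbb{C}}^*$ denotes its set of invertible elements (left and right invertibility coincide). A stem function is a holomorphic map $F:G\to A_{\mathbb{C}}$ with $F(\bar z)=\overline{F(z)}$. A slice regular function on $\Omega_G$ is a function $f:\Omega_G\to A$ associated to (induced by) a stem function $F=F'+iF''$ ($F',F'':G\to A$) via $f(x+yI)=F'(x+yi)+I\,F''(x+yi)$ for $x+yi\in G$, $I\in\mathbb{S}_A$. *)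

(* Defs.v *)
From HB Require Import structures.
From mathcomp Require Import all_boot all_order all_algebra.
From mathcomp Require Import complex.
From mathcomp Require Import all_classical all_reals all_analysis.

Set Implicit Arguments.
Unset Strict Implicit.
Unset Printing Implicit Defensive.

Import Order.TTheory GRing.Theory Num.Theory.
Import numFieldNormedType.Exports.

Local Open Scope classical_set_scope.
Local Open Scope ring_scope.
Local Open Scope complex_scope.

(* The topology of C = R[i] is the one given by its modulus. *)
HB.instance Definition _ (R : realType) := NormedModule.copy R[i] R[i]^o.

(* MathComp's ring and algebra structures are all associative, hence a
   structure of its own; [aone_neq0] makes R -> A, r |-> r *: aone, injective. *)
HB.mixin Record isAltStarAlgebra (R : realType) A of Vector R A := {
  amul : A -> A -> A;
  aone : A;
  aconj : A -> A;
  amul_linearl : forall b, linear (amul^~ b);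
  amul_linearr : forall a, linear (amul a);
  amul1l : left_id aone amul;
  amul1r : right_id aone amul;
  aone_neq0 : aone != 0;
  amul_altl : forall x y, amul x (amul x y) = amul (amul x x) y;
  amul_altr : forall x y, amul x (amul y y) = amul (amul x y) y;
  aconj_linear : linear aconj;
  aconjK : involutive aconj;
  aconj_mul : forall x y, aconj (amul x y) = amul (aconj y) (aconj x);
  aconj_real : forall r : R, aconj (r *: aone) = r *: aone
}.

#[short(type="altStarAlgType")]
HB.structure Definition AltStarAlgebra (R : realType) :=
  { A of isAltStarAlgebra R A & Vector R A }.

Section SymmetricDomain.
Context {R : realType}.
Implicit Type G : set R[i].

Definition conj_rel G : rel G :=
  fun z w => (set_val z == set_val w) || (set_val z == (set_val w)^*).

Lemma conj_rel_refl G : reflexive (@conj_rel G).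
Proof. by move=> z; rewrite /conj_rel eqxx. Qed.

Lemma conj_rel_sym G : symmetric (@conj_rel G).
Proof.
move=> z w; rewrite /conj_rel; congr (_ || _); first by rewrite eq_sym.
by apply/eqP/eqP => ->; rewrite conjcK.
Qed.

Lemma conj_rel_trans G : transitive (@conj_rel G).
Proof.
move=> w z v /orP[]/eqP zw /orP[]/eqP wv; rewrite /conj_rel zw wv ?conjcK eqxx ?orbT //.
Qed.

Canonical conj_equiv G :=
  EquivRel (@conj_rel G) (@conj_rel_refl G) (@conj_rel_sym G) (@conj_rel_trans G).

Definition conj_quotient G := quotient_topology {eq_quot (conj_equiv G)}%qT.

Definition symmetric_domain G : Prop :=
  [/\ G !=set0, open G, (forall z, G z <-> G z^*)
    & connected [set: conj_quotient G]].

Definition upper_part G : set R[i] := [set z | G z /\ 0 <= complex.Im z].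

End SymmetricDomain.

Section SliceGeometry.
Context {R : realType} {A : altStarAlgType R}.
Implicit Types (G : set R[i]) (D : set A).

Definition pseudosphere : set A :=
  [set w | w + aconj w = 0 /\ amul w (aconj w) = aone].

Definition slice_pt (x y : R) (I : A) : A := x *: aone + y *: I.

Lemma slice_pt_inj (x y x' y' : R) (I J : A) :
  pseudosphere I -> pseudosphere J ->
  slice_pt x y I = slice_pt x' y' J -> x = x' /\ `|y| = `|y'|.
Proof.
have one_inj (a b : R) : a *: aone = b *: aone :> A -> a = b.
  move=> /eqP; rewrite -subr_eq0 -scalerBl scaler_eq0 (negPf aone_neq0) orbF.
  by rewrite subr_eq0 => /eqP.
have conjE (a b : R) (u v : A) :
    aconj (a *: u + b *: v) = a *: aconj u + b *: aconj v.
  rewrite aconj_linear; congr (_ + _).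
  have aconj0 : aconj (0 : A) = 0 by rewrite -(scale0r aone) aconj_real scale0r.
  by rewrite -[b *: v]addr0 aconj_linear aconj0 addr0.
have sqE (c : R) (K : A) : pseudosphere K ->
    amul (c *: K) (aconj (c *: K)) = (c * c) *: aone.
  case=> _ K1; have -> : aconj (c *: K) = c *: aconj K.
    by have := conjE 0 c K K; rewrite !scale0r !add0r.
  have mulZl (d : R) (u v : A) : amul (d *: u) v = d *: amul u v.
    have := amul_linearl v d u 0; rewrite addr0 => ->.
    have := amul_linearl v (-1) u u; rewrite scaleN1r addNr scaleN1r addNr => ->.
    by rewrite addr0.
  have mulZr (d : R) (u v : A) : amul u (d *: v) = d *: amul u v.
    have := amul_linearr u d v 0; rewrite addr0 => ->.
    have := amul_linearr u (-1) v v; rewrite scaleN1r addNr scaleN1r addNr => ->.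
    by rewrite addr0.
  by rewrite mulZl mulZr K1 scalerA.
move=> SI SJ; rewrite /slice_pt => e.
have trE (a b : R) (K : A) : pseudosphere K ->
    (a *: aone + b *: K) + aconj (a *: aone + b *: K) = (a + a) *: aone.
  case=> K0 _; have c1 : aconj (aone : A) = aone.
    by have := aconj_real (s := A) 1; rewrite scale1r.
  by rewrite conjE c1 addrACA -scalerDl -scalerDr K0 scaler0 addr0.
have exx : x = x'.
  have := trE x y I SI; rewrite e trE // => /one_inj /eqP.
  by rewrite -!mulr2n eqrMn2r // => /eqP.
split=> //; move: e; rewrite exx => /addrI e.
have := sqE y I SI; rewrite e sqE // => /one_inj h.
by apply/eqP; rewrite -(eqrXn2 (n := 2)) // !real_normK ?num_real // !expr2 h.
Qed.

Definition axial_sphere (x y : R) : set A := slice_pt x y @` pseudosphere.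

Definition axial_domain G : set A :=
  [set q | exists x y I, [/\ G (x +i* y), pseudosphere I & q = slice_pt x y I]].

(* The image pi(D), described through the graph of
   pi (x + y I) = x + |y| i, a well-defined map by [slice_pt_inj]. *)
Definition pi_image D : set R[i] :=
  [set z | exists x y I,
    [/\ pseudosphere I, D (slice_pt x y I) & z = x +i* `|y|]].

Definition adapted G D : Prop :=
  [/\ D `<=` axial_domain G,
      (forall z, upper_part G z -> ~ limit_point (pi_image D) z)
    & (forall x y, axial_sphere x y `<=` D \/
         is_subset1 (axial_sphere x y `&` D))].

End SliceGeometry.

(* A (x)_R C, the pair (a, b) standing for a + i b. *)
Definition complexification {R : realType} (A : altStarAlgType R) : Type :=
  (A * A)%type.

Section StemFunctions.
Context {R : realType} {A : altStarAlgType R}.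
Local Notation AC := (complexification A).
Implicit Types (G : set R[i]) (F : R[i] -> AC) (f : A -> A).

Definition cmul (u v : AC) : AC :=
  (amul u.1 v.1 - amul u.2 v.2, amul u.1 v.2 + amul u.2 v.1).

Definition cone : AC := (aone, 0).

Definition cconj (u : AC) : AC := (u.1, - u.2).

Definition cinvertible (u : AC) : Prop :=
  exists v : AC, cmul u v = cone /\ cmul v u = cone.

(* The j-th complex coordinate of u in the complex basis of A (x)_R C given by
   a real basis of A. *)
Definition ccoord (j : 'I_(\dim {:A})) (u : AC) : R[i] :=
  coord (vbasis {:A}) j u.1 +i* coord (vbasis {:A}) j u.2.

(* Complex differentiability at every point of (the open set) G, of a map into
   a finite-dimensional complex vector space; it does not depend on the basis. *)
Definition holomorphic_on G F : Prop :=
  forall z, G z -> forall j, derivable (fun w => ccoord j (F w)) z 1.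

(* F and f are total; only their values on G, resp. on its axial domain, are
   constrained. *)
Definition stem_function G F : Prop :=
  holomorphic_on G F /\ forall z, G z -> F z^* = cconj (F z).

Definition induced_by G F f : Prop :=
  forall x y I, G (x +i* y) -> pseudosphere I ->
    f (slice_pt x y I) = (F (x +i* y)).1 + amul I (F (x +i* y)).2.

Definition slice_regular_with_stem G F f : Prop :=
  stem_function G F /\ induced_by G F f.

End StemFunctions.

(* Main.v *)
From HB Require Import structures.
Require Import Defs.
From mathcomp Require Import all_boot all_order all_algebra.
From mathcomp Require Import complex zify ring lra.
From mathcomp Require Import all_classical all_reals all_analysis.

(** A scalar holomorphic function with the prescribed zeros would produce only whole
    spheres of zeros. To get an isolated zero [x + y I], one uses the complex plane spanned
    by [1] and [I]: after complexification it splits by the idempotents [(1 -+ i I) / 2], so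
    that a pair formed by a scalar function [phi] and its reflection [z |-> conj (phi (conj z))]
    is a stem with values in that plane. If [phi] vanishes only at [p = x + i y], the stem is
    invertible away from [p] and its conjugate, while at [p] it is a multiple of [1 + i I].
    A function induced by a stem [F] vanishes over [J] at [z] exactly if
    [(1 - i J) F z = 0]; this is impossible when right multiplication by [F z] is injective,
    and for [F z] proportional to [1 + i I] it forces [J = I].

    The required function is obtained from an infinite product of such stems, one for each
    point of the projection of [D] (a scalar one for a whole sphere). Two difficulties come
    from the lack of associativity. The value at a zero of one factor must not be spoiled
    by the others: the scalar functions are chosen so as to take the value [1] at all
    the other points of the projection and at their conjugates, so the other factors are
    equal to [1] there ([ex_elementary_factor], [ex_stem_with_zeros]). And right
    multiplication by the product has to be injective elsewhere: each factor is put on both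
    sides, [P |-> e (P e)], because the right Moufang identity ([moufangr]) turns right
    multiplication by [e (P e)] into a composite of right multiplications; quantitative
    lower bounds then pass to the limit ([infinite_sandwich]).

    The scalar functions come from the classical constructions of Weierstrass and
    Mittag-Leffler on an arbitrary open set, in a form without integrals. Holomorphic means
    here uniformly approximable by polynomials on discs ([hol]); such functions are
    differentiable because averaging over roots of unity bounds the coefficients of a
    polynomial ([poly_coef_bound], [papx_derivable]). For [p] outside a large compact set,
    [z / p] or [(p - b) / (z - b)], with [b] outside [G], takes the value [1] only at [p]
    and is small on that compact set. From such a function [h], Newton's iteration
    [1 - h |-> (1 - h) exp h] produces a function with the only zero [p] that is close to
    [1] on the compact set ([ex_weierstrass_factor]), and powers of [h] produce the peak
    functions that solve the interpolation problem for its logarithms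
    ([ex_interpolation]).

    Finally [F] is invertible at any point of [G] outside the countable set of zeros and
    their conjugates, by a dimension count and the flexible law
    ([cinvertible_of_injr]). *)

Set Implicit Arguments.
Unset Strict Implicit.
Unset Printing Implicit Defensive.

Import Order.TTheory GRing.Theory Num.Theory.
Import numFieldNormedType.Exports.
Local Open Scope classical_set_scope.
Local Open Scope ring_scope.

(** * The modulus as a real number *)

Section Modulus.
Context {R : realType}.
Implicit Types (z w : R[i]) (x y : R).

(** The norm of a complex number lives in [R[i]]; all estimates below are between reals. *)
Definition cabs z : R := complex.Re `|z|.

Lemma normCabs z : `|z| = (cabs z)%:C%C.
Proof. by rewrite /cabs RRe_real // normr_real. Qed.

Lemma cabs_ge0 z : 0 <= cabs z.
Proof. by rewrite -ler0c -normCabs. Qed.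

Lemma cabs0 : cabs 0 = 0. Proof. by rewrite /cabs normr0. Qed.
Lemma cabs1 : cabs 1 = 1. Proof. by rewrite /cabs normr1. Qed.

Lemma cabs_eq0 z : (cabs z == 0) = (z == 0).
Proof.
apply/eqP/eqP => [h|->]; last by rewrite cabs0.
by apply/normr0_eq0; rewrite normCabs h.
Qed.

Lemma cabs_gt0 z : (0 < cabs z) = (z != 0).
Proof. by rewrite lt_def cabs_eq0 cabs_ge0 andbT. Qed.

Lemma cabsN z : cabs (- z) = cabs z.
Proof. by rewrite /cabs normrN. Qed.

Lemma cabsB z w : cabs (z - w) = cabs (w - z).
Proof. by rewrite -cabsN opprB. Qed.

Lemma cabsM z w : cabs (z * w) = cabs z * cabs w.
Proof. by apply: complexI; rewrite rmorphM /= -!normCabs normrM. Qed.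

Lemma cabsV z : cabs z^-1 = (cabs z)^-1.
Proof. by apply: complexI; rewrite fmorphV /= -!normCabs normfV. Qed.

Lemma cabsX z n : cabs (z ^+ n) = cabs z ^+ n.
Proof. by apply: complexI; rewrite rmorphXn /= -!normCabs normrX. Qed.

Lemma cabsJ z : cabs z^*%C = cabs z.
Proof. by rewrite /cabs normcJ. Qed.

Lemma cabsR x : cabs x%:C%C = `|x|.
Proof. by rewrite /cabs normc_def /= expr0n addr0 sqrtr_sqr. Qed.

Lemma cabs_nat n : cabs n%:R = n%:R.
Proof. by rewrite -(rmorph_nat (real_complex R)) cabsR normr_nat. Qed.

Lemma cabsD z w : cabs (z + w) <= cabs z + cabs w.
Proof. by rewrite -lecR rmorphD /= -!normCabs ler_normD. Qed.

Lemma cabsDB z w : cabs (z - w) <= cabs z + cabs w.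
Proof. by rewrite -(cabsN w) cabsD. Qed.

Lemma cabs_dist z w v : cabs (z - v) <= cabs (z - w) + cabs (w - v).
Proof. by rewrite -[z - v](subrKA w) cabsD. Qed.

Lemma cabs_ge z w : cabs z - cabs w <= cabs (z + w).
Proof.
by rewrite lerBlDr -{1}(addrK w z) cabsDB.
Qed.

Lemma cabs_sum (I : Type) (r : seq I) (Q : pred I) (F : I -> R[i]) :
  cabs (\sum_(i <- r | Q i) F i) <= \sum_(i <- r | Q i) cabs (F i).
Proof.
by apply: (big_ind2 (fun a b => cabs a <= b)) => [|a b c d ab cd|//];
  [rewrite cabs0 | rewrite (le_trans (cabsD _ _)) ?lerD].
Qed.

Lemma normRe_le z : `|complex.Re z| <= cabs z.
Proof. by rewrite -lecR -normCabs normc_ge_Re. Qed.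

Lemma normIm_le z : `|complex.Im z| <= cabs z.
Proof.
have := normRe_le (z * 'i%C); rewrite ReiNIm normrN cabsM.
by rewrite [X in _ * X](_ : _ = 1) ?mulr1 // /cabs normc_def /= expr0n add0r expr1n sqrtr1.
Qed.

Lemma cabs_leReIm z : cabs z <= `|complex.Re z| + `|complex.Im z|.
Proof.
rewrite [X in cabs X]complexE (le_trans (cabsD _ _))// cabsM !cabsR.
by rewrite [X in X * _](_ : _ = 1) ?mul1r // /cabs normc_def /= expr0n add0r expr1n sqrtr1.
Qed.

Lemma cabsi : cabs ('i%C : R[i]) = 1.
Proof. by rewrite /cabs normc_def /= expr0n add0r expr1n sqrtr1. Qed.

Lemma cabs_small_eq0 z : (forall e, 0 < e -> cabs z <= e) -> z = 0.
Proof.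
move=> h; apply/eqP; rewrite -cabs_eq0 eq_le cabs_ge0 andbT.
by apply/ler_addgt0Pl => e e0; rewrite addr0 h.
Qed.

End Modulus.

(** * Geometric convergence *)

Section Completeness.
Context {R : realType}.

(** Adding or subtracting twice the admissible error makes the sequence monotone, and the
    limit is the supremum of the lower envelope. *)
Lemma real_geometric_cvg (u : nat -> R) (M : R) :
    (forall n, `|u n.+1 - u n| <= M * 2^-1 ^+ n) ->
  exists l, forall n, `|u n - l| <= 2 * M * 2^-1 ^+ n.
Proof.
move=> h; pose d n : R := 2 * M * 2^-1 ^+ n.
have dS n : d n = d n.+1 + M * 2^-1 ^+ n.
  by rewrite /d exprS; lra.
have d_ge0 n : 0 <= d n.
  have := le_trans (normr_ge0 _) (h n).
  by rewrite /d => hh; lra.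
have a_mono n k : u n - d n <= u (n + k)%N - d (n + k)%N.
  elim: k => [|k IH]; first by rewrite addn0.
  rewrite addnS (le_trans IH) //.
  have := h (n + k)%N; rewrite ler_norml => /andP[h1 _].
  by rewrite (dS (n + k)%N); lra.
have b_mono n k : u (n + k)%N + d (n + k)%N <= u n + d n.
  elim: k => [|k IH]; first by rewrite addn0.
  rewrite addnS (le_trans _ IH) //.
  have := h (n + k)%N; rewrite ler_norml => /andP[_ h1].
  by rewrite (dS (n + k)%N); lra.
have ab m n : u m - d m <= u n + d n.
  apply: le_trans (a_mono m n) _; apply: le_trans (_ : _ <= u (n + m)%N + d (n + m)%N) _.
    by have := d_ge0 (m + n)%N; rewrite addnC; lra.
  exact: b_mono.
pose E := range (fun n => u n - d n).
have E0 : E !=set0 by exists (u 0%N - d 0%N), 0%N.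
exists (sup E) => n.
have Eub : has_ubound E by exists (u 0%N + d 0%N) => _ [m _ <-].
have h1 : u n - d n <= sup E by apply: ub_le_sup => //; exists n.
have h2 : sup E <= u n + d n by apply: ge_sup => // _ [m _ <-].
by rewrite ler_norml -/(d n); apply/andP; split; lra.
Qed.

Lemma complex_geometric_cvg (u : nat -> R[i]) (M : R) :
    (forall n, cabs (u n.+1 - u n) <= M * 2^-1 ^+ n) ->
  exists l, forall n, cabs (u n - l) <= 4 * M * 2^-1 ^+ n.
Proof.
move=> h.
have [|a ha] := @real_geometric_cvg (fun n => complex.Re (u n)) M.
  move=> n; apply: le_trans (h n); rewrite -(raddfB (@complex.Re R)).
  exact: normRe_le.
have [|b hb] := @real_geometric_cvg (fun n => complex.Im (u n)) M.
  move=> n; apply: le_trans (h n); rewrite -(raddfB (@complex.Im R)).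
  exact: normIm_le.
exists (a +i* b)%C => n; apply: le_trans (cabs_leReIm _) _.
have := ha n; have := hb n; case: (u n) => x y /=.
by move=> h1 h2; apply: le_trans (lerD h2 h1) _; lra.
Qed.

Lemma pow_half_small (e : R) : 0 < e -> exists n0, forall n, (n0 <= n)%N -> 2^-1 ^+ n <= e.
Proof.
move=> e0; have rn1 : `|2^-1 : R| < 1 by rewrite ger0_norm //; lra.
have /cvgrPdist_le /(_ _ e0) [n0 _ hn0] := cvg_expr rn1.
by exists n0 => n /hn0 /=; rewrite sub0r normrN ger0_norm ?exprn_ge0.
Qed.

End Completeness.

(** * The complex exponential *)

Section ComplexExponential.
Context {R : realType}.
Implicit Types (z w h : R[i]).

Definition cexp z : R[i] :=
  (expR (complex.Re z))%:C%C * (cos (complex.Im z) +i* sin (complex.Im z))%C.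

Lemma cexpD z w : cexp (z + w) = cexp z * cexp w.
Proof.
rewrite /cexp (raddfD (@complex.Re R)) (raddfD (@complex.Im R)) /= expRD rmorphM /=.
rewrite mulrACA; congr (_ * _); apply/eqP; rewrite eq_complex /= cosD sinD eqxx /=.
by apply/eqP; ring.
Qed.

Lemma cexp0 : cexp 0 = 1.
Proof. by rewrite /cexp /= expR0 cos0 sin0 mul1r. Qed.

Lemma cexpN z : cexp (- z) * cexp z = 1.
Proof. by rewrite -cexpD addNr cexp0. Qed.

Lemma cexp_neq0 z : cexp z != 0.
Proof.
apply/eqP => h; have := cexpN z; rewrite h mulr0 => /esym/eqP.
by rewrite oner_eq0.
Qed.

Lemma cexpMn z n : cexp (z *+ n) = cexp z ^+ n.
Proof. by elim: n => [|n IH]; rewrite ?mulr0n ?cexp0 // mulrS exprS cexpD IH. Qed.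

Lemma cabs_cis (t : R) : cabs (cos t +i* sin t)%C = 1.
Proof. by rewrite /cabs normc_def /= cos2Dsin2 sqrtr1. Qed.

Lemma cabs_cexp z : cabs (cexp z) = expR (complex.Re z).
Proof. by rewrite /cexp cabsM cabs_cis mulr1 cabsR ger0_norm // expR_ge0. Qed.

Lemma cabs_cexp_le z : cabs (cexp z) <= expR (cabs z).
Proof. by rewrite cabs_cexp ler_expR (le_trans (ler_norm _)) // normRe_le. Qed.

Lemma cexp_surj w : w != 0 -> exists z, cexp z = w.
Proof.
move=> w0; have r0 : 0 < cabs w by rewrite cabs_gt0.
pose x := complex.Re w / cabs w; pose y := complex.Im w / cabs w.
have xy : x ^+ 2 + y ^+ 2 = 1.
  rewrite !expr_div_n -mulrDl; have := add_Re2_Im2 w.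
  rewrite normCabs -rmorphXn => /complexI ->.
  by rewrite divff // expf_neq0 // gt_eqF.
have x1 : -1 <= x <= 1.
  rewrite -ler_norml -(ler_pXn2r (n := 2)) ?nnegrE ?ler01 //.
  by rewrite expr1n real_normK ?num_real // -xy lerDl sqr_ge0.
have sx : sin (acos x) = `|y|.
  by rewrite sin_acos // -xy [x ^+ 2 + _]addrC addrK sqrtr_sqr.
have cx : cos (acos x) = x by rewrite acosK.
have wE : w = ((cabs w) %:C * (x +i* y))%C.
  case: w w0 r0 @x @y xy x1 sx cx => a b w0 r0 x y _ _ _ _.
  apply/eqP; rewrite eq_complex /= !mul0r subr0 addr0 /x /y /=.
  by rewrite !mulrA ![cabs _ * _]mulrC !mulfK ?eqxx // gt_eqF.
exists (ln (cabs w) +i* (if 0 <= y then acos x else - acos x))%C.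
rewrite /cexp /= lnK // [RHS]wE; congr (_ * _)%R.
case: ifPn => y0; first by rewrite cx sx ger0_norm.
by rewrite cosN sinN cx sx ltr0_norm ?opprK // ltNge.
Qed.

Lemma sin_le_norm (t : R) : `|sin t| <= `|t|.
Proof.
wlog t0 : t / 0 <= t.
  move=> H; case: (leP 0 t) => [/H //|t0].
  by rewrite -normrN -sinN -(normrN t) H // oppr_ge0 ltW.
have cf : {within `[0, t], continuous (@sin R)}.
  by apply: continuous_subspaceT; exact: continuous_sin.
have [c _] := MVT_segment t0 (fun x _ => is_derive_sin x) cf.
rewrite sin0 !subr0 => ->; rewrite normrM ler_piMl // cos_max //.
Qed.

Lemma cosB1_le (t : R) : `|cos t - 1| <= t ^+ 2.
Proof.
have -> : cos t - 1 = - (2 * sin (t / 2) ^+ 2).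
  have := cos_mulr2n (t / 2); rewrite (_ : t / 2 *+ 2 = t); last by rewrite mulr2n; lra.
  by move=> ->; rewrite sin2cos2 mulr2n; lra.
rewrite normrN normrM normrX ger0_norm ?ler0n //.
have : `|sin (t / 2)| ^+ 2 <= `|t / 2| ^+ 2.
  by rewrite ler_pXn2r ?nnegrE // sin_le_norm.
rewrite [X in _ <= X -> _]real_normK ?num_real // expr_div_n => h.
by have := sqr_ge0 t; lra.
Qed.

Lemma sinB_le (t : R) : `|t| <= 1 -> `|sin t - t| <= t ^+ 2.
Proof.
wlog t0 : t / 0 <= t.
  move=> H; case: (leP 0 t) => [/H //|t0] t1.
  rewrite -normrN opprB -[X in X - _]opprK addrC -sinN -sqrrN H ?normrN //.
  by rewrite oppr_ge0 ltW.
move=> t1; have df (x : R) : is_derive x 1 (fun x : R => sin x - x) (cos x - 1).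
  exact: is_deriveB.
have cf : {within `[0, t], continuous (fun x : R => sin x - x)}.
  apply: continuous_subspaceT => x.
  by apply: cvgB; [exact: continuous_sin | exact: cvg_id].
have [c /itvP ct] := MVT_segment t0 (fun x _ => df x) cf.
rewrite sin0 !subr0 => ->; rewrite normrM expr2.
rewrite (ger0_norm t0) ler_wpM2r //.
apply: le_trans (cosB1_le _) _.
have := t1; rewrite ger0_norm // => t1'.
have c0 : 0 <= c by rewrite ct.
have c1 : c <= t by rewrite ct.
by rewrite expr2 (le_trans _ c1) // ler_piMr // (le_trans c1).
Qed.

(** The upper bound comes from [exp t (1 - t) <= exp t exp (- t) = 1]. *)
Lemma expRB1_le (t : R) : `|t| <= 2^-1 -> `|expR t - 1 - t| <= 2 * t ^+ 2.
Proof.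
rewrite ler_norml => /andP[t1 t2].
have h1 := expR_ge1Dx t; have h2 := expR_ge1Dx (- t).
have E0 := expR_gt0 t.
have : expR t * (1 - t) <= 1.
  by rewrite -[leRHS](expRxMexpNx_1 t) ler_pM2l.
move=> h3; rewrite ger0_norm; last by lra.
have h4 : 0 <= t ^+ 2 by exact: sqr_ge0.
have h5 : 1 <= (1 + t + 2 * t ^+ 2) * (1 - t).
  have -> : (1 + t + 2 * t ^+ 2) * (1 - t) = 1 + t ^+ 2 * (1 - 2 * t) by ring.
  by rewrite lerDl mulr_ge0 //; lra.
have : expR t <= 1 + t + 2 * t ^+ 2.
  rewrite -(ler_pM2r (x := 1 - t)); last by lra.
  exact: le_trans h3 h5.
by lra.
Qed.

Lemma cexpB1_le h : cabs h <= 2^-1 -> cabs (cexp h - 1 - h) <= 12 * cabs h ^+ 2.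
Proof.
case: h => x y hh; set r := cabs _ in hh *.
have xr : `|x| <= r by exact: (normRe_le (x +i* y)%C).
have yr : `|y| <= r by exact: (normIm_le (x +i* y)%C).
have r0 : 0 <= r by exact: cabs_ge0.
have sq (a : R) : `|a| <= r -> a ^+ 2 <= r ^+ 2.
  by move=> ha; rewrite -[a ^+ 2]real_normK ?num_real // ler_pXn2r ?nnegrE.
have hx := expRB1_le (le_trans xr hh).
have hc := cosB1_le y; have hs := sinB_le (le_trans yr (le_trans hh _)).
have {}hs : `|sin y - y| <= y ^+ 2 by apply: hs; lra.
have x2 := sq _ xr; have y2 := sq _ yr.
have E2 : expR x <= 2.
  move: hx; rewrite ler_norml => /andP[_ hx].
  move: (le_trans xr hh); rewrite ler_norml => /andP[_ h2].
  have : r ^+ 2 <= 2^-1 * 2^-1 by rewrite expr2 ler_pM.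
  by lra.
have E0 := expR_ge0 x.
have bx : `|expR x - 1| <= 2 * r.
  have -> : expR x - 1 = (expR x - 1 - x) + x by ring.
  apply: le_trans (ler_normD _ _) _.
  have : r ^+ 2 <= r * 2^-1 by rewrite expr2 ler_wpM2l.
  by lra.
have mulEle (a : R) : `|a| <= r ^+ 2 -> `|expR x * a| <= 2 * r ^+ 2.
  by move=> ha; rewrite normrM (ger0_norm E0) ler_pM.
have reE : complex.Re (cexp (x +i* y)%C - 1 - (x +i* y)%C)
    = expR x * (cos y - 1) + (expR x - 1 - x).
  by rewrite !raddfB /= mul0r subr0; ring.
have imE : complex.Im (cexp (x +i* y)%C - 1 - (x +i* y)%C)
    = expR x * (sin y - y) + (expR x - 1) * y.
  by rewrite !raddfB /= mul0r addr0; ring.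
apply: le_trans (cabs_leReIm _) _; rewrite reE imE.
have k1 := mulEle _ (le_trans hc y2); have k2 := mulEle _ (le_trans hs y2).
have k3 : `|(expR x - 1) * y| <= 2 * r ^+ 2.
  by rewrite normrM expr2 mulrA ler_pM.
have k4 := ler_normD (expR x * (cos y - 1)) (expR x - 1 - x).
have k5 := ler_normD (expR x * (sin y - y)) ((expR x - 1) * y).
by have r2 := sqr_ge0 r; lra.
Qed.

End ComplexExponential.

(** * Uniform approximation by polynomials *)

Section PolynomialApproximation.
Context {R : realType}.
Implicit Types (B : set R[i]) (f g : R[i] -> R[i]) (q : {poly R[i]}).

Definition cbounded B := exists M : R, forall w, B w -> cabs w <= M.

(** This stands in for holomorphy on a disc [B]: the class is visibly closed under uniform
    limits, sums, products and [cexp], and its members turn out to be complex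
    differentiable, so that no integration is ever needed. *)
Definition papx B f := forall e : R, 0 < e ->
  exists q, forall w, B w -> cabs (f w - q.[w]) <= e.

Lemma papx_poly B q : papx B (fun w => q.[w]).
Proof. by move=> e e0; exists q => w _; rewrite subrr cabs0 ltW. Qed.

Lemma papx_cst B (c : R[i]) : papx B (fun=> c).
Proof. by move=> e e0; exists c%:P => w _; rewrite hornerC subrr cabs0 ltW. Qed.

Lemma papx_id B : papx B id.
Proof. by move=> e e0; exists 'X => w _; rewrite hornerX subrr cabs0 ltW. Qed.

Lemma papx_lim B f :
    (forall e : R, 0 < e -> exists2 g, papx B g & forall w, B w -> cabs (f w - g w) <= e) ->
  papx B f.
Proof.
move=> h e e0; have e2 : 0 < e / 2 by rewrite divr_gt0.
have [g /(_ _ e2)[q hq] hg] := h _ e2; exists q => w Bw.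
by rewrite (le_trans (cabs_dist _ (g w) _)) // [leRHS](splitr e) lerD ?hg ?hq.
Qed.

Lemma eq_papx B f g : (forall w, B w -> f w = g w) -> papx B f -> papx B g.
Proof.
move=> fg hf; apply: papx_lim => e e0; exists f => // w Bw.
by rewrite fg // subrr cabs0 ltW.
Qed.

Lemma sub_papx B B' f : B' `<=` B -> papx B f -> papx B' f.
Proof. by move=> BB hf e /hf[q hq]; exists q => w /BB/hq. Qed.

Lemma papxD B f g : papx B f -> papx B g -> papx B (fun w => f w + g w).
Proof.
move=> hf hg e e0; have e2 : 0 < e / 2 by rewrite divr_gt0.
have [p hp] := hf _ e2; have [q hq] := hg _ e2; exists (p + q) => w Bw.
rewrite hornerD opprD addrACA (le_trans (cabsD _ _)) // [leRHS](splitr e).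
by rewrite lerD ?hp ?hq.
Qed.

Lemma poly_bounded B q : cbounded B ->
  exists2 M : R, 0 <= M & forall w, B w -> cabs q.[w] <= M.
Proof.
move=> [M hM]; elim/poly_ind: q => [|q c [N N0 hN]].
  by exists 0 => // w _; rewrite horner0 cabs0.
exists (N * `|M| + cabs c); first by rewrite addr_ge0 ?mulr_ge0 ?cabs_ge0.
move=> w Bw; rewrite hornerMXaddC (le_trans (cabsD _ _)) // lerD2r cabsM.
by rewrite ler_pM ?cabs_ge0 ?hN // (le_trans (hM _ Bw)) // ler_norm.
Qed.

Lemma papx_bounded B f : cbounded B -> papx B f ->
  exists2 M : R, 0 <= M & forall w, B w -> cabs (f w) <= M.
Proof.
move=> bB /(_ _ ltr01)[q hq]; have [M M0 hM] := poly_bounded q bB.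
exists (1 + M); first by rewrite addr_ge0.
move=> w Bw; rewrite -(subrK q.[w] (f w)) (le_trans (cabsD _ _)) //.
by rewrite lerD ?hq ?hM.
Qed.

Lemma papxM B f g : cbounded B -> papx B f -> papx B g ->
  papx B (fun w => f w * g w).
Proof.
move=> bB hf hg e e0.
have [M M0 hM] := papx_bounded bB hf.
have e1 : 0 < e / 2 / (M + 1) by rewrite !divr_gt0 // ltr_wpDl.
have [q hq] := hg _ e1; have [N N0 hN] := poly_bounded q bB.
have e2 : 0 < e / 2 / (N + 1) by rewrite !divr_gt0 // ltr_wpDl.
have [p hp] := hf _ e2; exists (p * q) => w Bw.
have -> : f w * g w - (p * q).[w] = f w * (g w - q.[w]) + (f w - p.[w]) * q.[w].
  by rewrite hornerM; ring.
rewrite (le_trans (cabsD _ _)) // !cabsM [leRHS](splitr e) lerD //.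
  apply: le_trans (_ : (M + 1) * (e / 2 / (M + 1)) <= _).
    by rewrite ler_pM ?cabs_ge0 ?hq // (le_trans (hM _ Bw)) // lerDl.
  by rewrite mulrC divfK // gt_eqF // ltr_wpDl.
apply: le_trans (_ : (e / 2 / (N + 1)) * (N + 1) <= _).
  by rewrite ler_pM ?cabs_ge0 ?hp // (le_trans (hN _ Bw)) // lerDl.
by rewrite divfK // gt_eqF // ltr_wpDl.
Qed.

Lemma papxX B f n : cbounded B -> papx B f -> papx B (fun w => f w ^+ n).
Proof.
move=> bB hf; elim: n => [|n IH]; first exact: papx_cst.
by apply: eq_papx (papxM bB hf IH) => w _; rewrite exprS.
Qed.

Lemma papxZ B f (c : R[i]) : cbounded B -> papx B f -> papx B (fun w => c * f w).
Proof. by move=> bB; apply: papxM => //; exact: papx_cst. Qed.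

Lemma papx_sum B (I : Type) (r : seq I) (Q : pred I) (F : I -> R[i] -> R[i]) :
    (forall i, Q i -> papx B (F i)) ->
  papx B (fun w => \sum_(i <- r | Q i) F i w).
Proof.
move=> hF; elim: r => [|i r IH].
  by apply: eq_papx (papx_cst B 0) => w _; rewrite big_nil.
case: (boolP (Q i)) => Qi.
  by apply: eq_papx (papxD (hF i Qi) IH) => w _; rewrite big_cons Qi.
by apply: eq_papx IH => w _; rewrite big_cons (negPf Qi).
Qed.

Lemma papx_conj B f :
  papx B f -> papx (fun w => B w^*%C) (fun w => (f w^*%C)^*%C).
Proof.
move=> hf e /hf[q hq]; exists (map_poly conjc q) => w Bw.
rewrite -{2}(conjcK w) horner_map -rmorphB /= cabsJ.
exact: hq.
Qed.

Lemma cabs_subXX (a b : R[i]) (K : R) n : 1 <= K -> cabs a <= K -> cabs b <= K ->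
  cabs (a ^+ n - b ^+ n) <= n%:R * cabs (a - b) * K ^+ n.
Proof.
move=> K1 aK bK; have K0 : 0 <= K by rewrite (le_trans ler01).
rewrite subrXX cabsM [n%:R * _]mulrC -mulrA ler_wpM2l ?cabs_ge0 //.
apply: le_trans (cabs_sum _ _ _) _.
rewrite mulr_natl -[n in _ *+ n]card_ord -sumr_const ler_sum // => i _.
rewrite cabsM !cabsX; apply: le_trans (_ : K ^+ (n.-1 - i) * K ^+ i <= _).
  by rewrite ler_pM ?exprn_ge0 ?cabs_ge0 // lerXn2r ?nnegrE ?cabs_ge0.
by rewrite -exprD ler_weXn2l //; have := ltn_ord i; lia.
Qed.

(** [exp w] and [(1 + w / n) ^ n] are [n]-th powers of numbers of modulus at most
    [exp (M / n)] whose difference is quadratic in [1 / n]. *)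
Lemma cexp_euler (M : R) w n : 0 <= M -> 2 * M + 1 <= n%:R -> cabs w <= M ->
  cabs (cexp w - (1 + w / n%:R) ^+ n) <= 12 * M ^+ 2 * expR M / n%:R.
Proof.
move=> M0 nM wM; have n0 : 0 < n%:R :> R by lra.
have nC0 : n%:R != 0 :> R[i].
  by rewrite pnatr_eq0 -lt0n -(ltr_nat R) //.
have wn : cabs (w / n%:R) <= M / n%:R.
  by rewrite cabsM cabsV cabs_nat ler_pM2r ?invr_gt0.
have Mn2 : M / n%:R <= 2^-1 by rewrite ler_pdivrMr //; lra.
have -> : cexp w = cexp (w / n%:R) ^+ n.
  by rewrite -cexpMn -[_ *+ n]mulr_natr divfK.
have K1 : 1 <= expR (M / n%:R) by rewrite -expR0 ler_expR divr_ge0 // ltW.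
have aK : cabs (cexp (w / n%:R)) <= expR (M / n%:R).
  by rewrite (le_trans (cabs_cexp_le _)) // ler_expR.
have bK : cabs (1 + w / n%:R) <= expR (M / n%:R).
  apply: le_trans (expR_ge1Dx _); rewrite (le_trans (cabsD _ _)) // cabs1.
  by rewrite lerD2l.
apply: le_trans (cabs_subXX n K1 aK bK) _.
rewrite -expRM_natl mulrC [n%:R * (M / _)]mulrC divfK ?gt_eqF //.
have -> : 12 * M ^+ 2 * expR M / n%:R = expR M * (n%:R * (12 * (M / n%:R) ^+ 2)).
  by field; rewrite gt_eqF.
rewrite ler_pM2l ?expR_gt0 // ler_pM2l //.
rewrite opprD addrA [X in cabs X](_ : _ = cexp (w / n%:R) - 1 - w / n%:R) ?addrA //.
apply: le_trans (cexpB1_le _) _; first exact: le_trans wn Mn2.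
by rewrite ler_pM2l // ler_pXn2r ?nnegrE ?cabs_ge0 ?divr_ge0 // ltW.
Qed.

Lemma papx_cexp B f : cbounded B -> papx B f -> papx B (fun w => cexp (f w)).
Proof.
move=> bB hf; have [M M0 hM] := papx_bounded bB hf.
apply: papx_lim => e e0.
pose X := 2 * M + 1 + 12 * M ^+ 2 * expR M / e.
have t0 : 0 <= 12 * M ^+ 2 * expR M / e.
  by rewrite divr_ge0 ?(ltW e0) // !mulr_ge0 ?expR_ge0.
have X0 : 0 <= X by rewrite /X; lra.
pose n := (Num.truncn X).+1.
have nX : X <= n%:R by rewrite ltW // truncnS_gt.
exists (fun w => (1 + f w / n%:R) ^+ n).
  apply: papxX => //; apply: papxD; first exact: papx_cst.
  by apply: papxM => //; exact: papx_cst.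
move=> w Bw; have Mn : 2 * M + 1 <= n%:R by apply: le_trans nX; rewrite /X lerDl.
apply: le_trans (cexp_euler M0 Mn (hM _ Bw)) _.
rewrite ler_pdivrMr ?ltr0n // [e * _]mulrC -ler_pdivrMr //.
by apply: le_trans nX; rewrite /X; lra.
Qed.

Definition cdisc (z : R[i]) (r : R) : set R[i] := [set w | cabs (w - z) <= r].

Lemma cdisc_bounded z r : cbounded (cdisc z r).
Proof.
exists (r + cabs z) => w zw; rewrite -(subrK z w).
by rewrite (le_trans (cabsD _ _)) // lerD2r.
Qed.

(** The geometric series in [(z - w) / (z - b)]. *)
Lemma papx_inv (z b : R[i]) (r : R) : 0 <= r -> r < cabs (z - b) ->
  papx (cdisc z r) (fun w => (w - b)^-1).
Proof.
move=> r0 rb; have zb0 : 0 < cabs (z - b) by apply: le_lt_trans rb.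
have zbn : z - b != 0 by rewrite -cabs_gt0.
pose t w := (z - w) / (z - b).
have rho1 : r / cabs (z - b) < 1 by rewrite ltr_pdivrMr // mul1r.
have rho0 : 0 <= r / cabs (z - b) by rewrite divr_ge0 // ltW.
set rho := r / _ in rho1 rho0.
have tle w : cdisc z r w -> cabs (t w) <= rho.
  by move=> zw; rewrite /t cabsM cabsV cabsB ler_pM2r // invr_gt0.
apply: papx_lim => e e0.
have e1 : 0 < e * (cabs (z - b) * (1 - rho)).
  by rewrite !mulr_gt0 // subr_gt0.
have [n hn] : exists n, rho ^+ n <= e * (cabs (z - b) * (1 - rho)).
  have rn1 : `|rho| < 1 by rewrite ger0_norm.
  have /cvgrPdist_le /(_ _ e1) [n _ /(_ n (leqnn n))] := cvg_expr rn1.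
  by rewrite sub0r normrN ger0_norm ?exprn_ge0 //; exists n.
exists (fun w => (z - b)^-1 * \sum_(i < n) t w ^+ i).
  apply: papxZ; first exact: cdisc_bounded.
  apply: papx_sum => i _; apply: papxX; first exact: cdisc_bounded.
  apply: papxM; [exact: cdisc_bounded | | exact: papx_cst].
  apply: papxD; first exact: papx_cst.
  by apply: eq_papx (papxZ (-1) (cdisc_bounded _ _) (@papx_id _)) => w _; rewrite mulN1r.
move=> w /tle tw.
have wbE : w - b = (z - b) * (1 - t w).
  by rewrite mulrBr mulr1 /t mulrCA divff // mulr1; ring.
have t1 : 1 - rho <= cabs (1 - t w).
  by have := cabs_ge 1 (- t w); rewrite cabs1 cabsN; lra.
have tn0 : 1 - t w != 0 by rewrite -cabs_gt0 (lt_le_trans _ t1) // subr_gt0.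
have -> : (w - b)^-1 - (z - b)^-1 * \sum_(i < n) t w ^+ i
    = (z - b)^-1 * (1 - t w)^-1 * t w ^+ n.
  have -> : t w ^+ n = 1 - (1 - t w) * \sum_(i < n) t w ^+ i.
    by have := subrX1 (t w) n; set S := \sum_(i < n) _ => h; rewrite -[LHS](subrK 1) h; ring.
  rewrite wbE; move: zbn tn0; set S := \sum_(i < n) _; set T := t w; clear.
  by move=> zb0 t0; field; rewrite zb0 t0.
rewrite !cabsM !cabsV cabsX -invfM mulrC ler_pdivrMr; last first.
  by rewrite mulr_gt0 // (lt_le_trans _ t1) // subr_gt0.
apply: le_trans (_ : rho ^+ n <= _).
  by rewrite lerXn2r ?nnegrE ?cabs_ge0.
apply: le_trans hn _; rewrite ler_pM2l // ler_pM2l //.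
Qed.

End PolynomialApproximation.

(** * Discrete Cauchy estimates and differentiability *)

Section CauchyEstimates.
Context {R : realType}.
Implicit Types (B : set R[i]) (f : R[i] -> R[i]) (q : {poly R[i]}).

(** A root of [X ^ (2 ^ k) + 1] has an order dividing [2 ^ k.+1] but not [2 ^ k]. *)
Lemma ex_prim_root_pow2 k : exists z : R[i], (2 ^ k.+1).-primitive_root z.
Proof.
pose z : R[i] := (2 ^ k).-root (-1).
have zk : z ^+ (2 ^ k) = -1 by rewrite /z rootCK // expn_gt0.
have z1 : z ^+ (2 ^ k.+1) = 1 by rewrite expnSr exprM zk -signr_odd.
exists z; have [//|m mz mk] := prim_order_exists _ z1; first by rewrite expn_gt0.
suff <- : m = (2 ^ k.+1)%N by [].
have /(dvdn_pfactor _ _ _)[//|j jk mE] := mk.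
rewrite mE; congr (2 ^ _)%N; apply/eqP; rewrite eqn_leq jk /= ltnNge.
apply/negP => jk'; have : (m %| 2 ^ k)%N by rewrite mE dvdn_exp2l.
by rewrite (prim_order_dvd mz) zk eq_sym -addr_eq0 -mulr2n pnatr_eq0.
Qed.

(** Averaging over roots of unity of order larger than the degree extracts a
    coefficient exactly: a discrete, integral-free Cauchy formula. *)
Lemma poly_coef_bound q (r M : R) j : 0 < r ->
    (forall w, cabs w <= r -> cabs q.[w] <= M) ->
  cabs q`_j * r ^+ j <= M.
Proof.
move=> r0 hM.
have M0 : 0 <= M.
  by apply: le_trans (cabs_ge0 _) (hM 0 _); rewrite cabs0 ltW.
have [jq|jq] := ltnP j (size q); last first.
  by rewrite nth_default // cabs0 mul0r.
have [z zp] := ex_prim_root_pow2 (size q); set N := (2 ^ _)%N in zp.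
have Nq : (size q < N)%N by rewrite (ltn_trans (ltnSn _)) // ltn_expl.
have N0 : (0 < N)%N by rewrite expn_gt0.
have az : cabs z = 1.
  apply/eqP; rewrite -(pexpr_eq1 (n := N)) ?cabs_ge0 //.
  by rewrite -cabsX (prim_expr_order zp) cabs1.
have orth i : (i < size q)%N ->
    \sum_(k < N) (z ^+ (i + (N - j))) ^+ k = if i == j then N%:R else 0.
  move=> iq; case: eqP => [->|/eqP ij].
    rewrite subnKC; last by rewrite ltnW // (ltn_trans jq).
    rewrite (prim_expr_order zp) (eq_bigr (fun=> 1)) => [|k _]; last by rewrite expr1n.
    by rewrite sumr_const card_ord.
  have x1 : z ^+ (i + (N - j)) != 1.
    rewrite -(prim_order_dvd zp); apply: contra ij => /dvdnP[c hc].
    apply/eqP; case: c hc => [|[|c]]; rewrite ?mul0n ?mul1n ?mulSn; lia.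
  have := subrX1 (z ^+ (i + (N - j))) N; rewrite -exprM mulnC exprM.
  rewrite (prim_expr_order zp) expr1n subrr => /esym/eqP.
  by rewrite mulf_eq0 subr_eq0 (negPf x1) => /eqP.
have key : \sum_(k < N) q.[r%:C%C * z ^+ k] * (z ^+ (N - j)) ^+ k
    = N%:R * (q`_j * r%:C%C ^+ j).
  under eq_bigr => k _ do rewrite horner_coef mulr_suml.
  rewrite exchange_big /= (bigD1 (Ordinal jq)) //= [X in _ + X]big1 ?addr0.
    rewrite (eq_bigr (fun k : 'I_N => q`_j * r%:C%C ^+ j * (z ^+ (j + (N - j))) ^+ k)).
      by rewrite -mulr_sumr orth // eqxx mulrC.
    by move=> k _; rewrite exprD !exprMn -!exprM [(k * j)%N]mulnC; ring.
  move=> i ij.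
  rewrite (eq_bigr (fun k : 'I_N => q`_i * r%:C%C ^+ i * (z ^+ (i + (N - j))) ^+ k)).
    rewrite -mulr_sumr orth //; have -> : (i == j :> nat) = false by apply: negPf.
    by rewrite mulr0.
  by move=> k _; rewrite exprD !exprMn -!exprM [(k * i)%N]mulnC; ring.
have : cabs (N%:R * (q`_j * r%:C%C ^+ j)) <= N%:R * M.
  rewrite -key (le_trans (cabs_sum _ _ _)) // mulr_natl -[N in _ *+ N]card_ord -sumr_const.
  apply: ler_sum => k _; rewrite cabsM !cabsX az !expr1n mulr1 hM //.
  by rewrite cabsM cabsR cabsX az expr1n mulr1 gtr0_norm.
by rewrite !cabsM cabs_nat cabsX cabsR gtr0_norm // ler_pM2l // ltr0n.
Qed.

Lemma poly_taylor1_bound q (r M : R) h : 0 < r ->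
    (forall w, cabs w <= r -> cabs q.[w] <= M) -> cabs h <= r / 2 ->
  cabs (q.[h] - q`_0 - q`_1 * h) <= 2 * M / r ^+ 2 * cabs h ^+ 2.
Proof.
move=> r0 hM hr; have M0 : 0 <= M.
  by apply: le_trans (cabs_ge0 _) (hM 0 _); rewrite cabs0 ltW.
have [n qn] : exists n, (size q <= n.+2)%N by exists (size q); rewrite ltnW.
have -> : q.[h] - q`_0 - q`_1 * h = \sum_(i < n) q`_i.+2 * h ^+ i.+2.
  rewrite (horner_coef_wide _ qn) 2!big_ord_recl expr0 expr1 mulr1.
  rewrite [X in _ + (_ + X)](eq_bigr (fun i : 'I_n => q`_i.+2 * h ^+ i.+2)) //.
  by rewrite [q`_ord0 + _]addrC addrK [X in X - _]addrC addrK.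
apply: le_trans (cabs_sum _ _ _) _.
apply: le_trans (_ : \sum_(i < n) M / r ^+ 2 * cabs h ^+ 2 * 2^-1 ^+ i <= _).
  apply: ler_sum => i _; rewrite cabsM cabsX.
  have := poly_coef_bound i.+2 r0 hM; rewrite -ler_pdivlMr ?exprn_gt0 // => h1.
  apply: le_trans (ler_wpM2r _ h1) _; first by rewrite exprn_ge0 ?cabs_ge0.
  have -> : M / r ^+ i.+2 * cabs h ^+ i.+2 = M / r ^+ 2 * cabs h ^+ 2 * (cabs h / r) ^+ i.
    rewrite -addn2 !exprD expr_div_n; field.
    by rewrite !expf_neq0 // gt_eqF.
  rewrite ler_wpM2l // ?mulr_ge0 ?invr_ge0 ?exprn_ge0 ?cabs_ge0 ?(ltW r0) //.
  rewrite lerXn2r ?nnegrE ?divr_ge0 ?cabs_ge0 ?(ltW r0) ?invr_ge0 //.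
  by rewrite ler_pdivrMr // mulrC.
rewrite -mulr_sumr [leRHS](_ : _ = M / r ^+ 2 * cabs h ^+ 2 * 2); last by ring.
rewrite ler_wpM2l // ?mulr_ge0 ?invr_ge0 ?exprn_ge0 ?cabs_ge0 ?(ltW r0) //.
have := subrX1 (2^-1 : R) n; have : 0 <= (2^-1 : R) ^+ n by rewrite exprn_ge0.
by lra.
Qed.

(** The Taylor remainders of the approximating polynomials have a common quadratic bound,
    and the Cauchy estimate makes their linear coefficients converge. *)
Lemma papx_derivable f z (r : R) : 0 < r -> papx (cdisc z r) f -> derivable f z 1.
Proof.
move=> r0 hf.
have [M0 M0_ge hM0] := papx_bounded (cdisc_bounded z r) hf.
have /choice[p hp] : forall n, exists p : {poly R[i]}, forall h, cabs h <= r ->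
    cabs (f (z + h) - p.[h]) <= 2^-1 ^+ n.
  move=> n; have e0 : 0 < (2^-1 : R) ^+ n by rewrite exprn_gt0.
  have [q hq] := hf _ e0; exists (q \Po ('X + z%:P)) => h hr.
  rewrite horner_comp !hornerE [h + z]addrC; apply: hq.
  by rewrite /cdisc /= addrC addKr.
pose M := M0 + 1.
have pM n w : cabs w <= r -> cabs (p n).[w] <= M.
  move=> wr; rewrite -(subKr (f (z + w)) (p n).[w]) (le_trans (cabsDB _ _)) //.
  apply: lerD; first by apply: hM0; rewrite /cdisc /= [z + w]addrC addrK.
  by rewrite (le_trans (hp n _ wr)) // exprn_ile1 //; lra.
have [L hL] : exists L, forall n, cabs ((p n)`_1 - L) <= 4 * (2 / r) * 2^-1 ^+ n.
  apply: (@complex_geometric_cvg _ (fun n => (p n)`_1)) => n.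
  rewrite -[_ / r * _]mulrAC ler_pdivlMr // -coefB -{1}[r]expr1.
  apply: poly_coef_bound => // w wr; rewrite hornerD hornerN.
  apply: le_trans (cabs_dist _ (f (z + w)) _) _.
  have h1 := hp n.+1 _ wr; have h2 := hp n _ wr.
  rewrite cabsB in h1; apply: le_trans (lerD h1 h2) _.
  by rewrite exprS; have : 0 <= (2^-1 : R) ^+ n by [rewrite exprn_ge0]; lra.
pose C := 2 * M / r ^+ 2.
have quad h : cabs h <= r / 2 -> cabs (f (z + h) - f z - L * h) <= C * cabs h ^+ 2.
  move=> hr; have hr' : cabs h <= r by apply: le_trans hr _; lra.
  apply/ler_addgt0Pl => e e0.
  pose K := 2 + 4 * (2 / r) * cabs h.
  have K0 : 0 < K.
    rewrite ltr_wpDr // !mulr_ge0 ?cabs_ge0 ?invr_ge0 ?(ltW r0) //.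
  have [n hn] : exists n, (2^-1 : R) ^+ n <= e / K.
    have [n hn] := pow_half_small (divr_gt0 e0 K0).
    by exists n; exact: hn.
  have -> : f (z + h) - f z - L * h = (f (z + h) - (p n).[h]) - (f z - (p n)`_0)
      + ((p n)`_1 - L) * h + ((p n).[h] - (p n)`_0 - (p n)`_1 * h) by ring.
  apply: le_trans (cabsD _ _) _; apply: lerD; last by apply: poly_taylor1_bound => // w; exact: pM.
  apply: le_trans (_ : 2^-1 ^+ n * K <= _); last by move: hn; rewrite ler_pdivlMr.
  rewrite mulrDr; apply: le_trans (cabsD _ _) _; apply: lerD.
    apply: le_trans (cabsDB _ _) _.
    have h1 := hp n _ hr'; have h2 := hp n 0.
    rewrite addr0 horner_coef0 cabs0 in h2.
    by apply: le_trans (lerD h1 (h2 (ltW r0))) _; lra.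
  by rewrite cabsM mulrA ler_wpM2r ?cabs_ge0 // mulrC hL.
apply/cvg_ex; exists L; apply/cvgrPdist_le => e e0.
have eE : e = (complex.Re e)%:C%C by rewrite RRe_real // ger0_real // ltW.
have {e0} e0 : 0 < complex.Re e by rewrite -ltcR -eE.
have C0 : 0 < C + 1.
  rewrite ltr_wpDl // /C !mulr_ge0 ?invr_ge0 ?exprn_ge0 ?(ltW r0) //.
  by rewrite /M; lra.
pose d := Num.min (r / 2) (complex.Re e / (C + 1)).
have d0 : 0 < d by rewrite lt_min !divr_gt0.
near=> h.
have h0 : h != 0 by near: h; exact: nbhs_dnbhs_neq.
have hd : cabs h <= d.
  rewrite -lecR -normCabs; near: h; apply: dnbhs0_le.
  by rewrite -[0]/(0%:C)%C ltcR.
have hr : cabs h <= r / 2 by apply: le_trans hd _; rewrite ge_min lexx.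
have he : cabs h <= complex.Re e / (C + 1).
  by apply: le_trans hd _; rewrite ge_min lexx orbT.
rewrite eE normCabs lecR /=.
have -> : L - h^-1 * (f (h * 1 + z) - f z) = - (h^-1 * (f (z + h) - f z - L * h)).
  by rewrite mulr1 [h + z]addrC; field.
rewrite cabsN cabsM cabsV mulrC ler_pdivrMr ?cabs_gt0 //.
apply: le_trans (quad _ hr) _; rewrite expr2 mulrA ler_wpM2r ?cabs_ge0 //.
move: he; rewrite ler_pdivlMr // mulrC; apply: le_trans.
by rewrite ler_wpM2r ?cabs_ge0 // lerDl.
Unshelve. all: by end_near. Qed.

End CauchyEstimates.

(** * Holomorphic functions on an open set and their limits *)

Section HolomorphicByApproximation.
Context {R : realType}.
Implicit Types (G : set R[i]) (f g : R[i] -> R[i]) (z w : R[i]).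

(** The discs that matter are those with a concentric larger disc inside [G]: on them
    [1 / (w - b)] is a uniform limit of polynomials for every [b] outside [G]. *)
Definition hol G f := forall z (r r' : R), 0 <= r -> r < r' ->
  (forall w, cabs (w - z) < r' -> G w) -> papx (cdisc z r) f.

Section Closure.
Variable G : set R[i].

Lemma hol_poly q : hol G (fun w => q.[w]).
Proof. by move=> z r r' _ _ _; exact: papx_poly. Qed.

Lemma hol_cst c : hol G (fun=> c).
Proof. by move=> z r r' _ _ _; exact: papx_cst. Qed.

Lemma hol_id : hol G id.
Proof. by move=> z r r' _ _ _; exact: papx_id. Qed.

Lemma holD f g : hol G f -> hol G g -> hol G (fun w => f w + g w).
Proof.
by move=> hf hg z r r' r0 rr zG; apply: papxD; [apply: hf zG | apply: hg zG].
Qed.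

Lemma holM f g : hol G f -> hol G g -> hol G (fun w => f w * g w).
Proof.
move=> hf hg z r r' r0 rr zG; apply: papxM; first exact: cdisc_bounded.
  exact: hf zG.
exact: hg zG.
Qed.

Lemma holB f g : hol G f -> hol G g -> hol G (fun w => f w - g w).
Proof.
move=> hf hg; have := holD hf (holM (hol_cst (-1)) hg).
by rewrite (_ : (fun w => _ + -1 * _) = (fun w => f w - g w)) //; apply/funext => w; rewrite mulN1r.
Qed.

Lemma holX f n : hol G f -> hol G (fun w => f w ^+ n).
Proof.
by move=> hf z r r' r0 rr zG; apply: papxX; [exact: cdisc_bounded | apply: hf zG].
Qed.

Lemma hol_sum (I : Type) (s : seq I) (Q : pred I) (F : I -> R[i] -> R[i]) :
    (forall i, Q i -> hol G (F i)) ->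
  hol G (fun w => \sum_(i <- s | Q i) F i w).
Proof.
move=> hF z r r' r0 rr zG; apply: papx_sum => i Qi.
exact: (hF i Qi) zG.
Qed.

Lemma hol_cexp f : hol G f -> hol G (fun w => cexp (f w)).
Proof.
by move=> hf z r r' r0 rr zG; apply: papx_cexp; [exact: cdisc_bounded | apply: hf zG].
Qed.

Lemma hol_inv b : ~ G b -> hol G (fun w => (w - b)^-1).
Proof.
move=> Gb z r r' r0 rr zG; apply: papx_inv => //; apply: lt_le_trans rr _.
by rewrite leNgt; apply/negP; rewrite cabsB => /zG.
Qed.

Lemma hol_conj f : (forall z, G z <-> G z^*%C) -> hol G f ->
  hol G (fun w => (f w^*%C)^*%C).
Proof.
move=> Gs hf z r r' r0 rr zG; have := hf z^*%C r r' r0 rr.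
move=> /(_ _)/papx_conj H; apply: sub_papx (H _).
  by move=> w; rewrite /cdisc /= -rmorphB cabsJ.
by move=> w h; apply/Gs/zG; rewrite -cabsJ rmorphB /= conjcK.
Qed.

End Closure.

(** Consecutive members differ by a factor [100], so that a point missed by one of them
    yields functions of modulus at most [1 / 100] on the previous one; the first two are
    made empty in order that a point of low depth be subject to no constraint. *)
Definition exhaustion G (n : nat) : set R[i] :=
  [set z | [/\ (1 < n)%N, cabs z <= 100 ^+ n & forall b, ~ G b -> 100^-1 ^+ n <= cabs (z - b)]].

Section Exhaustion.
Variable G : set R[i].
Local Notation K := (exhaustion G).

Lemma exhaustion_leq m n : (m <= n)%N -> K m `<=` K n.
Proof.
move=> mn z [m1 mz mb]; split; first exact: leq_trans m1 mn.
  by apply: le_trans mz _; rewrite ler_weXn2l // ler1n.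
move=> b /mb; apply: le_trans; rewrite ler_wiXn2l //.
by lra.
Qed.

Lemma exhaustion_sub n : K n `<=` G.
Proof.
move=> z [_ _ zb]; apply: contrapT => /zb; rewrite subrr cabs0.
by apply/negP; rewrite -ltNge exprn_gt0 // invr_gt0.
Qed.

Lemma exhaustion_small n : (n <= 1)%N -> K n = set0.
Proof. by move=> n1; apply/seteqP; split=> // z [+ _ _]; rewrite ltnNge n1. Qed.

Lemma exhaustion_conj n z : (forall z, G z <-> G z^*%C) -> K n z -> K n z^*%C.
Proof.
move=> Gs [n1 nz zb]; split; rewrite ?cabsJ // => b Gb.
rewrite -cabsJ rmorphB /= conjcK; apply: zb => /Gs; rewrite conjcK.
exact: Gb.
Qed.

Lemma ex_exp100_ge (x : R) : exists n, x <= 100 ^+ n.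
Proof.
exists (Num.truncn `|x|).+1; apply: le_trans (ler_norm _) _.
apply: le_trans (ltW (truncnS_gt _)) _.
by rewrite -natrX ler_nat ltnW // ltn_expl.
Qed.

Lemma cdisc_exhaustion z (r r' : R) : r < r' ->
    (forall w, cabs (w - z) < r' -> G w) ->
  exists n, cdisc z r `<=` K n.
Proof.
move=> rr zG; have [n hn] := ex_exp100_ge (r + cabs z).
have [m hm] := ex_exp100_ge (r' - r)^-1.
exists (maxn 2 (maxn m n)) => w zw; split; first by rewrite leq_max.
  rewrite -(subrK z w) (le_trans (cabsD _ _)) //.
  apply: le_trans (lerD zw (lexx _)) _; apply: le_trans hn _.
  by rewrite ler_weXn2l ?ler1n // !leq_max leqnn !orbT.
move=> b Gb; apply: le_trans (_ : r' - r <= _).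
  apply: le_trans (_ : 100^-1 ^+ m <= _).
    by rewrite ler_wiXn2l // ?leq_max ?leqnn ?orbT //; lra.
  by rewrite exprVn -[leRHS]invrK lef_pV2 ?posrE ?invr_gt0 ?exprn_gt0 ?subr_gt0.
have : r' <= cabs (b - z) by rewrite leNgt; apply/negP => /zG.
have := cabs_dist b w z; rewrite (cabsB b w); move: zw; rewrite /cdisc /=.
by lra.
Qed.

Hypothesis Gopen : forall z, G z -> exists2 r : R, 0 < r & forall w, cabs (w - z) < r -> G w.

Lemma ex_exhaustion z : G z -> exists n, K n z.
Proof.
move=> /Gopen[r r0 zG]; have [n hn] := cdisc_exhaustion r0 zG.
by exists n; apply: hn; rewrite /cdisc /= subrr cabs0.
Qed.

Lemma hol_derivable f z : hol G f -> G z -> derivable f z 1.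
Proof.
move=> hf /Gopen[r r0 zG]; apply: (@papx_derivable _ _ _ (r / 2)).
  by rewrite divr_gt0.
by apply: hf zG; [rewrite divr_ge0 // ltW | lra].
Qed.

(** The convergence is required with uniform constants on discs only, but the limit is
    controlled pointwise, with whatever constants are available at the given point. *)
Lemma hol_geometric_lim (u : nat -> R[i] -> R[i]) :
    (forall n, hol G (u n)) ->
    (forall z (r r' : R), 0 <= r -> r < r' -> (forall w, cabs (w - z) < r' -> G w) ->
      exists N (d : R), forall n w, (N <= n)%N -> cdisc z r w ->
       cabs (u n.+1 w - u n w) <= d * 2^-1 ^+ n) ->
  exists2 f, hol G f & forall z N (d : R), G z ->
    (forall n, (N <= n)%N -> cabs (u n.+1 z - u n z) <= d * 2^-1 ^+ n) ->
    forall n, (N <= n)%N -> cabs (u n z - f z) <= 4 * d * 2^-1 ^+ n.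
Proof.
move=> hu hgeo.
have tail N (d : R) z : (forall n, (N <= n)%N -> cabs (u n.+1 z - u n z) <= d * 2^-1 ^+ n) ->
    exists l, forall n, (N <= n)%N -> cabs (u n z - l) <= 4 * d * 2^-1 ^+ n.
  move=> h; have [|l hl] := @complex_geometric_cvg _ (fun n => u (N + n)%N z) (d * 2^-1 ^+ N).
    by move=> n; rewrite addnS -mulrA -exprD; apply: h; rewrite leq_addr.
  exists l => n Nn; have := hl (n - N)%N.
  by rewrite subnKC // mulrA -mulrA -exprD subnKC.
have small (d e : R) : 0 < e -> exists n0, forall n, (n0 <= n)%N -> d * 2^-1 ^+ n <= e.
  move=> e0; have d1 : 0 < `|d| + 1 by rewrite ltr_wpDl.
  have [n0 hn0] := pow_half_small (divr_gt0 e0 d1).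
  exists n0 => n /hn0; rewrite ler_pdivlMr // mulrC.
  apply: le_trans; rewrite ler_wpM2r ?exprn_ge0 //.
  by rewrite (le_trans (ler_norm _)) // lerDl.
have /choice[f hf] : forall z, exists l, G z -> forall N (d : R),
    (forall n, (N <= n)%N -> cabs (u n.+1 z - u n z) <= d * 2^-1 ^+ n) ->
    forall n, (N <= n)%N -> cabs (u n z - l) <= 4 * d * 2^-1 ^+ n.
  move=> z; have [Gz|] := pselect (G z); last by exists 0.
  have [r r0 zG] := Gopen Gz; have [N0 [d0 h0]] := hgeo z 0 r (lexx _) r0 zG.
  have [|l hl] := tail N0 d0 z.
    by move=> n Nn; apply: h0; rewrite // /cdisc /= subrr cabs0.
  exists l => _ N d h; have [l' hl'] := tail N d z h.
  suff -> : l = l' by [].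
  apply/eqP; rewrite -subr_eq0; apply/eqP/cabs_small_eq0 => e e0.
  have [n0 hn0] := small (4 * d0 + 4 * d) e e0.
  pose n := maxn n0 (maxn N0 N).
  have := hn0 n; rewrite leq_max leqnn => /(_ isT); apply: le_trans.
  apply: le_trans (cabs_dist _ (u n z) _) _; rewrite mulrDl lerD //.
    by rewrite cabsB hl // !leq_max leqnn !orbT.
  by rewrite hl' // !leq_max leqnn !orbT.
exists f; last by move=> z N d Gz h; exact: hf.
move=> z r r' r0 rr zG; apply: papx_lim => e e0.
have [N [d h]] := hgeo z r r' r0 rr zG; have [n0 hn0] := small (4 * d) e e0.
exists (u (maxn n0 N)); first exact: hu zG.
move=> w zw; have Gw : G w by apply: zG; apply: le_lt_trans rr.
rewrite cabsB; have := hn0 (maxn n0 N); rewrite leq_max leqnn => /(_ isT); apply: le_trans.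
apply: (hf w Gw N) => //; rewrite ?leq_max ?leqnn ?orbT //.
by move=> n Nn; exact: h.
Qed.

(** A point outside [K n.+1] is either far from the origin, and then [z / p] will do, or
    close to a point [b] outside [G], and then [(p - b) / (z - b)] will do. *)
Lemma ex_small_simple_value p n : G p -> (1 < n)%N -> ~ K n.+1 p ->
  exists h, [/\ hol G h, (forall z, G z -> h z = 1 <-> z = p)
    & forall z, K n z -> cabs (h z) <= 100^-1].
Proof.
move=> Gp n1 Kp; have [big|small] := ltP (100 ^+ n.+1) (cabs p).
  have p0 : p != 0 by rewrite -cabs_gt0 (lt_trans _ big) // exprn_gt0.
  exists (fun z => z / p); split.
  - by apply: holM; [exact: hol_id | exact: hol_cst].
  - by move=> z _; split=> [/(congr1 ( *%R^~ p))|->]; rewrite ?mul1r ?divff // divfK.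
  - move=> z [_ zn _]; rewrite cabsM cabsV ler_pdivrMr ?cabs_gt0 //.
    apply: le_trans zn _; rewrite ler_pdivlMl // -exprS.
    exact: ltW.
have [b [Gb pb]] : exists b, ~ G b /\ cabs (p - b) < 100^-1 ^+ n.+1.
  apply: contrapT => H; apply: Kp; split=> //; first exact: leqW.
  by move=> b Gb; rewrite leNgt; apply/negP => h; apply: H; exists b.
have zb z : G z -> z - b != 0.
  by move=> Gz; rewrite subr_eq0; apply/eqP => zb; apply: Gb; rewrite -zb.
exists (fun z => (p - b) * (z - b)^-1); split.
- by apply: holM; [exact: hol_cst | exact: hol_inv].
- move=> z /zb z0; split=> [/(congr1 ( *%R^~ (z - b)))|->]; rewrite ?divff ?zb // divfK // mul1r.
  by move/addIr.
- move=> z Kz; have Gz := exhaustion_sub Kz; case: Kz => _ _ /(_ b Gb) h.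
  rewrite cabsM cabsV ler_pdivrMr ?cabs_gt0 ?zb //.
  apply: le_trans (ltW pb) _; rewrite exprS.
  by rewrite ler_pM2l // invr_gt0.
Qed.

End Exhaustion.
End HolomorphicByApproximation.

(** * Logarithms near 1 by Newton's iteration *)

Section LocalLogarithm.
Context {R : realType}.
Implicit Types (e w : R[i]).

(** To first order [exp e] is [1 / (1 - e)], so that the factor [exp e] corrects [1 - e]
    up to a quadratic error. *)
Lemma newton_step e : cabs e <= 100^-1 ->
  cabs (1 - (1 - e) * cexp e) <= 2^-1 * cabs e.
Proof.
move=> he; have he' : cabs e <= 2^-1 by lra.
have := cexpB1_le he'; set rho := _ - _ - e => hr.
have -> : 1 - (1 - e) * cexp e = e ^+ 2 - rho * (1 - e) by rewrite /rho; ring.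
apply: le_trans (cabsDB _ _) _; rewrite cabsX cabsM.
have h1 : cabs (1 - e) <= 2.
  by apply: le_trans (cabsDB _ _) _; rewrite cabs1; lra.
have h2 : cabs rho * cabs (1 - e) <= 12 * cabs e ^+ 2 * 2.
  by rewrite ler_pM ?cabs_ge0.
have h3 : cabs e ^+ 2 <= 100^-1 * cabs e.
  by rewrite expr2 ler_wpM2r ?cabs_ge0.
have := cabs_ge0 e; lra.
Qed.

Fixpoint newton e n := if n is n'.+1 then 1 - (1 - newton e n') * cexp (newton e n') else e.

Lemma newton_le e n : cabs e <= 100^-1 -> cabs (newton e n) <= cabs e * 2^-1 ^+ n.
Proof.
move=> he; elim: n => [|n IH]; first by rewrite mulr1.
have p1 : (2^-1 : R) ^+ n <= 1 by rewrite exprn_ile1 //; lra.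
apply: le_trans (newton_step _) _.
  apply: le_trans IH _; apply: le_trans he; apply: ler_piMr => //.
  exact: cabs_ge0.
by rewrite exprS; lra.
Qed.

Lemma newton_prod e n :
  1 - newton e n = (1 - e) * cexp (\sum_(i < n) newton e i).
Proof.
elim: n => [|n IH]; first by rewrite big_ord0 cexp0 mulr1.
rewrite big_ord_recr cexpD mulrA; move: IH => /= <-; ring.
Qed.

Lemma cexp_near0 e : cabs e <= 2^-1 -> cabs (cexp e - 1) <= 7 * cabs e.
Proof.
move=> he; rewrite -(subrK e (cexp e - 1)) (le_trans (cabsD _ _)) //.
have := cexpB1_le he; have : cabs e ^+ 2 <= 2^-1 * cabs e.
  by rewrite expr2 ler_wpM2r ?cabs_ge0.
by lra.
Qed.

(** With [w = 1 - e], the product [w exp (e_0 + ... + e_n)] tends to [1], and the errors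
    [e_i] decrease geometrically: minus their sum is a logarithm of [w]. *)
Lemma small_log w : cabs (w - 1) <= 100^-1 ->
  exists2 l, cexp l = w & cabs l <= 4 * cabs (w - 1).
Proof.
rewrite cabsB; set e := 1 - w => he.
have wE : w = 1 - e by rewrite /e opprB addrC subrK.
pose L n := \sum_(i < n) newton e i.
have [|l hl] := @complex_geometric_cvg _ L (cabs e).
  by move=> n; rewrite /L big_ord_recr /= [X in cabs X]addrC addKr newton_le.
have l0 : cabs l <= 4 * cabs e.
  by have := hl 0%N; rewrite /L big_ord0 sub0r cabsN mulr1.
exists (- l); last by rewrite cabsN.
suff wl : w * cexp l = 1.
  by apply: (mulIf (cexp_neq0 l)); rewrite cexpN wl.
apply/eqP; rewrite -subr_eq0; apply/eqP/cabs_small_eq0 => d d0.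
pose c : R := 28 * cabs (w * cexp l) + 1.
have c0 : 0 < c by rewrite /c; have := cabs_ge0 (w * cexp l); lra.
have [n hn] := pow_half_small (divr_gt0 d0 c0).
have {}hn := hn n (leqnn n); set x := 2^-1 ^+ n in hn.
have x0 : 0 <= x by rewrite exprn_ge0.
have x1 : x <= 1 by rewrite exprn_ile1 //; lra.
have e0 := cabs_ge0 e.
have ex : cabs e * x <= 100^-1 * x by rewrite ler_wpM2r.
have hd : cabs (L n - l) <= 25^-1 * x.
  by apply: le_trans (hl n) _; rewrite -/x; lra.
have -> : w * cexp l - 1 = - (w * cexp l) * (cexp (L n - l) - 1) - newton e n.
  have := newton_prod e n; rewrite -wE -/(L n) => h.
  have -> : newton e n = 1 - w * cexp (L n) by rewrite -h; ring.
  have -> : cexp (L n) = cexp (L n - l) * cexp l by rewrite -cexpD subrK.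
  by ring.
have h1 : cabs (newton e n) <= 100^-1 * x := le_trans (newton_le n he) ex.
have h2 : cabs (cexp (L n - l) - 1) <= 28 * x.
  by apply: le_trans (cexp_near0 _) _; lra.
apply: le_trans (cabsDB _ _) _; rewrite cabsM cabsN.
apply: le_trans (_ : x * c <= _); last by rewrite -ler_pdivlMr.
have := ler_wpM2l (cabs_ge0 (w * cexp l)) h2; rewrite /c; lra.
Qed.

End LocalLogarithm.

(** * Weierstrass factors and interpolation *)

Section Interpolation.
Context {R : realType}.
Variable G : set R[i].
Hypothesis Gopen : forall z, G z -> exists2 r : R, 0 < r & forall w, cabs (w - z) < r -> G w.
Local Notation K := (exhaustion G).

(** Newton's iteration started at [h] multiplies [1 - h] by exponentials only: it brings
    the function close to [1] without creating or destroying any zero. *)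
Lemma ex_weierstrass_factor h n (d : R) : hol G h ->
    (forall z, K n z -> cabs (h z) <= 100^-1) -> 0 < d ->
  exists phi, [/\ hol G phi, (forall z, phi z = 0 <-> h z = 1)
    & forall z, K n z -> cabs (phi z - 1) <= d].
Proof.
move=> hh hK d0; have [k hk] := pow_half_small d0.
have hnew i : hol G (fun z => newton (h z) i).
  elim: i => [//|i IH] /=; apply: holB; first exact: hol_cst.
  by apply: holM; [apply: holB => //; exact: hol_cst | exact: hol_cexp].
exists (fun z => 1 - newton (h z) k); split.
- by apply: holB => //; exact: hol_cst.
- move=> z; rewrite newton_prod; split=> [/eqP|->]; last by rewrite subrr mul0r.
  by rewrite mulf_eq0 (negPf (cexp_neq0 _)) orbF subr_eq0 => /eqP.
- move=> z Kz; rewrite [X in cabs X]addrC addKr cabsN.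
  apply: le_trans (newton_le k (hK _ Kz)) _.
  apply: le_trans (hk k (leqnn k)); rewrite ler_piMl ?exprn_ge0 //.
  by apply: le_trans (hK _ Kz) _; lra.
Qed.

(** The level of [p] lies three below the first index whose set contains [p]. One unit is
    the ratio needed by [ex_small_simple_value], and another keeps two consecutive sets
    away from [p]: the factor vanishing at [p] is made close to [1] on the larger one,
    and interpolation corrects it on the smaller one. *)
Lemma ex_level : exists level : R[i] -> nat, [/\
  forall p, G p -> exists h, [/\ hol G h, (forall z, G z -> h z = 1 <-> z = p)
    & forall z, K (level p).+1 z -> cabs (h z) <= 100^-1],
  (forall p m, G p -> ~ K m.+1 p -> (m <= (level p).+1)%N)
  & forall p j, G p -> (level p < j)%N -> K (j + 3) p].
Proof.
have /choice[lev hlev] : forall p, exists n, G p -> K n p /\ forall m, (m < n)%N -> ~ K m p.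
  move=> p; have [Gp|] := pselect (G p); last by exists 0%N.
  have ex : exists n, `[< K n p >].
    by have [n Kn] := ex_exhaustion Gopen Gp; exists n; apply/asboolP.
  exists (ex_minn ex) => _; case: ex_minnP => n /asboolP Kn nmin; split=> // m mn Km.
  by have := nmin m (asboolT Km); rewrite leqNgt mn.
exists (fun p => lev p - 3)%N; split.
- move=> p Gp; have [Kp Kmin] := hlev p Gp.
  have [l3|l3] := leqP (lev p) 3.
    exists (fun z => 1 - (z - p)); split.
    + apply: holB; first exact: hol_cst.
      by apply: holB; [exact: hol_id | exact: hol_cst].
    + move=> z _; split=> [/eqP|->]; last by rewrite subrr subr0.
      by rewrite -subr_eq0 addrC addKr oppr_eq0 subr_eq0 => /eqP.
    + have K0 : K (lev p - 3).+1 = set0 by apply: exhaustion_small; lia.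
      by move=> z; rewrite K0.
  apply: ex_small_simple_value => //; first by lia.
  by apply: Kmin; lia.
- move=> p m Gp Kp; have [Kl _] := hlev p Gp.
  have : ~ (lev p <= m.+1)%N by move=> /exhaustion_leq/(_ _ Kl).
  by lia.
- move=> p j Gp lj; have [Kl _] := hlev p Gp.
  by apply: exhaustion_leq Kl; lia.
Qed.

Lemma exhaustion_bounded n : cbounded (K n).
Proof. by exists (100 ^+ n) => w []. Qed.

Definition lagrange (s : seq R[i]) (q : R[i]) : {poly R[i]} :=
  \prod_(a <- s | a != q) (('X - a%:P) * ((q - a)^-1)%:P).

Lemma lagrange1 s q : (lagrange s q).[q] = 1.
Proof.
rewrite /lagrange horner_prod big1 // => a aq.
by rewrite !hornerE divff // subr_eq0 eq_sym.
Qed.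

Lemma lagrange0 s q a : a \in s -> a != q -> (lagrange s q).[a] = 0.
Proof.
move=> sa aq; rewrite /lagrange horner_prod; apply/eqP.
rewrite prodf_seq_eq0; apply/hasP; exists a => //.
by rewrite aq !hornerE subrr mul0r eqxx.
Qed.

(** A high power of [h] is as small as desired where [h] is at most [1 / 100], which pays
    for the size of a Lagrange polynomial. *)
Lemma ex_peak h n q (s : seq R[i]) (d : R) : hol G h -> h q = 1 ->
    (forall z, K n z -> cabs (h z) <= 100^-1) -> 0 < d ->
  exists eta, [/\ hol G eta, eta q = 1, (forall a, a \in s -> a != q -> eta a = 0)
    & forall z, K n z -> cabs (eta z) <= d].
Proof.
move=> hh hq hK d0.
have [M M0 hM] := poly_bounded (lagrange s q) (exhaustion_bounded n).
have M1 : 0 < M + 1 by rewrite ltr_wpDl.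
have [k hk] := pow_half_small (divr_gt0 d0 M1).
exists (fun z => h z ^+ k * (lagrange s q).[z]); split.
- by apply: holM; [exact: holX | exact: hol_poly].
- by rewrite hq expr1n mul1r lagrange1.
- by move=> a sa aq; rewrite lagrange0 ?mulr0.
- move=> z Kz; rewrite cabsM cabsX.
  have := hk k (leqnn k); rewrite ler_pdivlMr //; apply: le_trans.
  rewrite ler_pM ?exprn_ge0 ?cabs_ge0 //.
    rewrite lerXn2r ?nnegrE ?cabs_ge0 //.
    by apply: le_trans (hK _ Kz) _; lra.
  by apply: le_trans (hM _ Kz) _; rewrite lerDl.
Qed.

Variables (P : set R[i]) (rank_of : R[i] -> nat) (level : R[i] -> nat).
Hypothesis PG : P `<=` G.
Hypothesis Pfin : forall n, finite_set (P `&` K n).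
Hypothesis rank_inj : forall p q, P p -> P q -> rank_of p = rank_of q -> p = q.
Hypothesis level_small : forall p, G p -> exists h, [/\ hol G h,
  (forall z, G z -> h z = 1 <-> z = p)
  & forall z, K (level p).+1 z -> cabs (h z) <= 100^-1].
Hypothesis level_ge : forall p m, G p -> ~ K m.+1 p -> (m <= (level p).+1)%N.
Hypothesis level_proper : forall j, exists N, forall p, P p -> (N <= rank_of p)%N ->
  (j <= level p)%N.

(** Interpolation at all the points of [P] at once: Lagrange's formula on [K m.+1],
    then one peak function per remaining point, each vanishing at the points
    already treated. *)
Lemma ex_interpolation m : exists2 B : R, 0 <= B & forall (d e : R) (t : R[i] -> R[i]),
    0 <= d -> 0 < e -> (forall p, P p -> K m.+1 p -> cabs (t p) <= d) ->
  exists psi, [/\ hol G psi, (forall p, P p -> psi p = t p)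
    & forall z, K m z -> cabs (psi z) <= B * d + e].
Proof.
have /finite_seqP[s0 s0E] := Pfin m.+1; pose s := undup s0.
have sP p : (p \in s) <-> (P p /\ K m.+1 p).
  rewrite mem_undup; have : (P `&` K m.+1) p = (p \in s0) by rewrite s0E.
  by move=> <-.
have /choice[M hM] : forall p, exists M : R, 0 <= M /\
    forall z, K m z -> cabs (lagrange s p).[z] <= M.
  move=> p; have [M M0 h] := poly_bounded (lagrange s p) (exhaustion_bounded m).
  by exists M.
exists (\sum_(p <- s) M p); first by rewrite sumr_ge0 // => p _; case: (hM p).
move=> d e t d0 e0 td.
pose pt n := xget 0 [set p | P p /\ rank_of p = n].
have ptK p : P p -> pt (rank_of p) = p.
  move=> Pp; rewrite /pt; case: xgetP => [q _ [Pq qp]|/(_ p)[]//].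
  exact: rank_inj.
(* The indices that enumerate a point which the Lagrange polynomials have not treated. *)
pose good n := [/\ P (pt n), rank_of (pt n) = n & ~ K m.+1 (pt n)].
have /choice[eta heta] : forall nd : nat * R, exists eta : R[i] -> R[i], 0 < nd.2 ->
    [/\ hol G eta,
      good nd.1 -> [/\ eta (pt nd.1) = 1,
        forall p, P p -> p <> pt nd.1 -> K m.+1 p \/ (rank_of p < nd.1)%N -> eta p = 0
        & forall z, K (level (pt nd.1)).+1 z -> cabs (eta z) <= nd.2]
      & ~ good nd.1 -> eta = fun=> 0].
  case=> n d' /=; have [[Pp pn Kp]|bad] := pselect (good n); last first.
    by exists (fun=> 0) => _; split=> //; exact: hol_cst.
  have [d'0|] := pselect (0 < d'); last by exists (fun=> 0).
  have [h [hh h1 hK]] := level_small (PG Pp).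
  have hp : h (pt n) = 1 by apply/h1 => //; exact: PG.
  have [f [fh f1 f0 fK]] := ex_peak (s ++ [seq pt j | j <- iota 0 n]) hh hp hK d'0.
  exists f => _; split=> //; last by case.
  move=> _; split=> // p Pq /eqP pq [Kq|qn]; apply: f0 => //; rewrite mem_cat.
    by rewrite (introT idP (proj2 (sP p) (conj Pq Kq))).
  apply/orP; right; apply/mapP; exists (rank_of p); rewrite ?ptK //.
  by rewrite mem_iota.
pose c n (psi : R[i] -> R[i]) := t (pt n) - psi (pt n).
pose del n (psi : R[i] -> R[i]) : R := e / 4 * 2^-1 ^+ n / (cabs (c n psi) + 1).
pose psi := fix psi n : R[i] -> R[i] := if n is n'.+1 then
  (fun z => psi n' z + c n' (psi n') * eta (n', del n' (psi n')) z)
  else (fun z => \sum_(p <- s) t p * (lagrange s p).[z]).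
have del0 n f : 0 < del n f.
  by rewrite !divr_gt0 ?mulr_gt0 ?divr_gt0 ?exprn_gt0 // ltr_wpDl ?cabs_ge0.
have psi_hol n : hol G (psi n).
  elim: n => [|n IH] /=.
    by apply: hol_sum => p _; apply: holM; [exact: hol_cst | exact: hol_poly].
  apply: holD => //; apply: holM; first exact: hol_cst.
  by have [] := heta (n, del n (psi n)) (del0 _ _).
have psi_step n z : good n -> K (level (pt n)).+1 z ->
    cabs (psi n.+1 z - psi n z) <= e / 4 * 2^-1 ^+ n.
  move=> gn Kz; rewrite /= [X in cabs X]addrC addKr cabsM.
  have [_ /(_ gn)[_ _ /(_ _ Kz) h] _] := heta (n, del n (psi n)) (del0 _ _).
  apply: le_trans (_ : (cabs (c n (psi n)) + 1) * del n (psi n) <= _).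
    by rewrite ler_pM ?cabs_ge0 // lerDl.
  by rewrite /del mulrC divfK // gt_eqF // ltr_wpDl ?cabs_ge0.
have psi_bad n : ~ good n -> psi n.+1 = psi n.
  move=> gn; apply/funext => z /=.
  have [_ _ /(_ gn) ->] := heta (n, del n (psi n)) (del0 _ _).
  by rewrite mulr0 addr0.
have half_ge0 n : 0 <= e / 4 * 2^-1 ^+ n.
  by rewrite mulr_ge0 ?exprn_ge0 ?divr_ge0 // ltW.
have psi_geo j : exists N (d' : R), forall n z, (N <= n)%N -> K j z ->
    cabs (psi n.+1 z - psi n z) <= d' * 2^-1 ^+ n.
  have [N hN] := level_proper j; exists N, (e / 4) => n z Nn Kz.
  have [gn|/psi_bad ->] := pselect (good n); last by rewrite subrr cabs0.
  apply: psi_step => //; apply: exhaustion_leq Kz; case: gn => Pp pn _.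
  by apply: leqW; apply: hN => //; rewrite pn.
have [|f fh flim] := hol_geometric_lim Gopen psi_hol.
  move=> z r r' r0 rr zG; have [j Kj] := cdisc_exhaustion rr zG.
  by have [N [d' hd]] := psi_geo j; exists N, d' => n w Nn /Kj; exact: hd.
have stepm n z : (0 <= n)%N -> K m z -> cabs (psi n.+1 z - psi n z) <= e / 4 * 2^-1 ^+ n.
  move=> _ Kz; have [gn|/psi_bad ->] := pselect (good n); last by rewrite subrr cabs0.
  apply: psi_step => //; apply: exhaustion_leq Kz; case: gn => Pp pn Kp.
  by apply: level_ge => //; exact: PG.
exists f; split=> //.
- move=> p Pp; have [j Kj] := ex_exhaustion Gopen (PG Pp).
  have psi_keep n : (psi n p = t p) -> (K m.+1 p \/ (rank_of p < n)%N) -> psi n.+1 p = t p.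
    move=> pn hp; have [gn|/psi_bad -> //] := pselect (good n).
    have [_ /(_ gn)[_ h _] _] := heta (n, del n (psi n)) (del0 _ _).
    rewrite /= pn h ?mulr0 ?addr0 // => pE; case: gn => _; rewrite /= -pE => pn' Kp.
    by case: hp => [//|]; rewrite pn' ltnn.
  have [n0 psi_p] : exists n0, forall n, (n0 <= n)%N -> psi n p = t p.
    have [Kp|Kp] := pselect (K m.+1 p).
      exists 0%N; elim=> [_|n IH _]; last by apply: psi_keep; [exact: IH | left].
      have ps : p \in s by apply/sP.
      rewrite /= (bigD1_seq p) ?undup_uniq //= lagrange1 mulr1 big1_seq ?addr0 //.
      by move=> q /andP[qp qs]; rewrite lagrange0 ?mulr0 // eq_sym.
    exists (rank_of p).+1; elim=> [//|n IH]; rewrite ltnS leq_eqVlt => /orP[/eqP pn|pn].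
      have gn : good n by rewrite /good -pn ptK.
      have [_ /(_ gn)[h _ _] _] := heta (n, del n (psi n)) (del0 _ _).
      have ptn : pt n = p by rewrite -pn ptK.
      move: h; rewrite [X in pt X]/= ptn => h.
      by rewrite /= h /c ptn; ring.
    by apply: psi_keep; [exact: IH | right].
  have [N [d' hd]] := psi_geo j.
  apply/eqP; rewrite -subr_eq0; apply/eqP/cabs_small_eq0 => x x0.
  have dd : 0 < 4 * `|d'| + 1 by rewrite ltr_wpDl // mulr_ge0.
  have [n1 hn1] := pow_half_small (divr_gt0 x0 dd).
  pose n := maxn n1 (maxn N n0).
  rewrite -(psi_p n) ?leq_max ?leqnn ?orbT // cabsB.
  apply: le_trans (flim p N d' (PG Pp) _ n _) _.
  - by move=> k Nk; exact: hd.
  - by rewrite !leq_max leqnn !orbT.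
  have := hn1 n; rewrite leq_max leqnn => /(_ isT); rewrite ler_pdivlMr // mulrC.
  apply: le_trans; rewrite ler_wpM2r ?exprn_ge0 //.
  by have := ler_norm d'; lra.
- move=> z Kz.
  have h1 := flim z 0%N _ (exhaustion_sub Kz) (fun n _ => stepm n z isT Kz) 0%N isT.
  rewrite mulr1 in h1; rewrite -(subKr (psi 0%N z) (f z)).
  apply: le_trans (cabsDB _ _) _; apply: lerD; last by apply: le_trans h1 _; lra.
  rewrite /= mulr_suml; apply: le_trans (cabs_sum _ _ _) _.
  rewrite big_seq [leRHS]big_seq; apply: ler_sum => p /sP[Pp Kp].
  by rewrite cabsM mulrC ler_pM ?cabs_ge0 ?td //; case: (hM p) => _; exact.
Qed.

(** A Weierstrass factor [phi0] for [p] takes arbitrary nonzero values at the other points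
    of [P]; multiplying it by the exponential of a function that interpolates the opposite
    of its logarithms makes these values [1]. Where [phi0] is already close to [1] the
    logarithms can be chosen small, hence so is the interpolating function. *)
Lemma ex_elementary_factor p (d : R) : P p -> 0 < d ->
  exists phi, [/\ hol G phi, (forall z, G z -> phi z = 0 <-> z = p),
    (forall q, P q -> q <> p -> phi q = 1)
    & forall z, K (level p) z -> cabs (phi z - 1) <= d].
Proof.
move=> Pp d0; set m := level p.
have [h [hh h1 hK]] := level_small (PG Pp).
have [B B0 hB] := ex_interpolation m.
(* [s] bounds the exponent [psi] on [K m] and [d1] bounds [phi0 - 1] there: the final
   error is at most [5 * d1 + 7 * s]. *)
pose s : R := Num.min (d / 14) 2^-1.
have s0 : 0 < s by rewrite lt_min; apply/andP; split; lra.
have B1 : 0 < 8 * (B + 1) by rewrite mulr_gt0 // ltr_wpDl.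
pose d1 : R := Num.min (d / 10) (Num.min 100^-1 (s / (8 * (B + 1)))).
have d10 : 0 < d1.
  rewrite !lt_min (divr_gt0 s0 B1) andbT; apply/andP; split; lra.
have sd : s <= d / 14 by rewrite ge_min lexx.
have s2 : s <= 2^-1 by rewrite ge_min lexx orbT.
have d1d : d1 <= d / 10 by rewrite ge_min lexx.
have d1c : d1 <= 100^-1 by rewrite !ge_min lexx !orbT.
have d1B : 8 * (B + 1) * d1 <= s.
  by rewrite mulrC -ler_pdivlMr // !ge_min lexx !orbT.
have [phi0 [phi0h phi00 phi0K]] := ex_weierstrass_factor hh hK d10.
have /choice[t ht] : forall q, exists l, P q -> q <> p ->
    cexp l * phi0 q = 1 /\ (K m.+1 q -> cabs l <= 4 * d1).
  move=> q; have [[Pq qp]|H] := pselect (P q /\ q <> p); last first.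
    by exists 0 => Pq qp; exfalso; apply: H.
  have phiq : phi0 q != 0 by apply/eqP => /phi00 /h1 qE; apply: qp; apply: qE; exact: PG.
  have [Kq|Kq] := pselect (K m.+1 q).
    have hq := phi0K _ Kq; have [l le1 l1] := small_log (le_trans hq d1c).
    exists (- l) => _ _; rewrite cabsN -le1 cexpN; split=> // _.
    by apply: le_trans l1 _; rewrite ler_pM2l.
  have [l le1] := cexp_surj phiq.
  by exists (- l) => _ _; rewrite -le1 cexpN.
(* There is no logarithm at [p], where [phi0] vanishes: [0] is a default value. *)
pose t' q := if q == p then 0 else t q.
have [||q Pq Kq|psi [psih psiP psiK]] := hB (4 * d1) (s / 2) t'.
- by rewrite mulr_ge0 // ltW.
- by rewrite divr_gt0.
- rewrite /t'; case: eqP => qp; first by rewrite cabs0 mulr_ge0 // ltW.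
  by have [_] := ht q Pq qp; exact.
exists (fun z => phi0 z * cexp (psi z)); split.
- by apply: holM => //; exact: hol_cexp.
- move=> z Gz; rewrite -h1 // -phi00; split=> [/eqP|->]; last by rewrite mul0r.
  by rewrite mulf_eq0 (negPf (cexp_neq0 _)) orbF => /eqP.
- move=> q Pq qp; rewrite psiP // /t'; case: eqP => // _; rewrite mulrC.
  by have [] := ht q Pq qp.
move=> z Kz; have hp := psiK _ Kz.
have ps : cabs (psi z) <= s.
  apply: le_trans hp _.
  have := mulr_ge0 B0 (ltW d10); have := ltW d10; move: d1B; rewrite mulrDr !mulrDl => *; lra.
have c7 : cabs (cexp (psi z) - 1) <= 7 * cabs (psi z).
  by apply: cexp_near0; apply: le_trans ps _.
have h0 : cabs (phi0 z - 1) <= d1 by apply: phi0K; apply: exhaustion_leq Kz.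
have -> : phi0 z * cexp (psi z) - 1 = (phi0 z - 1) * (1 + (cexp (psi z) - 1)) + (cexp (psi z) - 1).
  by ring.
apply: le_trans (cabsD _ _) _; rewrite cabsM.
have h5 : cabs (1 + (cexp (psi z) - 1)) <= 5.
  by apply: le_trans (cabsD _ _) _; rewrite cabs1; lra.
have := ler_pM (cabs_ge0 _) (cabs_ge0 _) h0 h5.
by lra.
Qed.

End Interpolation.

(** * Alternative algebras and their complexification *)

Section Moufang.
Variables (V : zmodType) (m : V -> V -> V).
Hypothesis mDl : forall a b c, m (a + b) c = m a c + m b c.
Hypothesis mDr : forall a b c, m a (b + c) = m a b + m a c.
Hypothesis altl : forall x y, m x (m x y) = m (m x x) y.
Hypothesis altr : forall x y, m x (m y y) = m (m x y) y.

Lemma alternative_linearl x y z : m x (m y z) + m y (m x z) = m (m x y + m y x) z.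
Proof.
have := altl (x + y) z; rewrite !mDl !mDr !mDl !altl.
by rewrite -!addrA => /addrI; rewrite !addrA => /addIr ->.
Qed.

Lemma alternative_linearr x y z : m (m x y) z + m (m x z) y = m x (m y z + m z y).
Proof.
have := altr x (y + z); rewrite !mDr !mDl !mDr -!altr.
rewrite -!addrA => /addrI; rewrite !addrA => /addIr h.
by rewrite [LHS]addrC -h addrC.
Qed.

Lemma flexible x a : m x (m a x) = m (m x a) x.
Proof.
have := alternative_linearl x a x; rewrite mDl altr => h.
exact: addIr h.
Qed.

(** The right Moufang identity, the substitute for associativity in infinite products. It
    compares the linearized left law at [(y x, a, x)] with the right law at [(y, x, a x)]. *)
Lemma moufangr x a y : m y (m x (m a x)) = m (m (m y x) a) x.
Proof.
have E1 := alternative_linearl (m y x) a x.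
have E2 := alternative_linearr y x (m a x).
have E3 : m (m a (m y x)) x + m (m y (m a x)) x = m a (m (m y x) x) + m y (m (m a x) x).
  by rewrite -mDl alternative_linearl -altr -alternative_linearl !altr.
rewrite mDl in E1; rewrite mDr in E2.
apply: (addIr (m y (m (m a x) x))); rewrite -E2.
apply: (addIr (m a (m (m y x) x))); rewrite addrAC E1.
by rewrite -!addrA [_ + m a (m (m y x) x)]addrC -E3.
Qed.

End Moufang.

Section AltStarAlgebra.
Context {R : realType} {A : altStarAlgType R}.
Implicit Types (a b c : A) (r : R).

Lemma amulDl a b c : amul (a + b) c = amul a c + amul b c.
Proof. by have := amul_linearl c 1 a b; rewrite !scale1r. Qed.

Lemma amulDr a b c : amul a (b + c) = amul a b + amul a c.
Proof. by have := amul_linearr a 1 b c; rewrite !scale1r. Qed.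

Lemma amul0l a : amul 0 a = 0.
Proof. by apply: (addIr (amul 0 a)); rewrite -amulDl !add0r. Qed.

Lemma amul0r a : amul a 0 = 0.
Proof. by apply: (addIr (amul a 0)); rewrite -amulDr !add0r. Qed.

Lemma amulZl r a b : amul (r *: a) b = r *: amul a b.
Proof. by have := amul_linearl b r a 0; rewrite amul0l !addr0. Qed.

Lemma amulZr r a b : amul a (r *: b) = r *: amul a b.
Proof. by have := amul_linearr a r b 0; rewrite amul0r !addr0. Qed.

Lemma amulNl a b : amul (- a) b = - amul a b.
Proof. by rewrite -scaleN1r amulZl scaleN1r. Qed.

Lemma amulNr a b : amul a (- b) = - amul a b.
Proof. by rewrite -scaleN1r amulZr scaleN1r. Qed.

Lemma aconjN a : aconj (- a) = - aconj a.
Proof.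
have c0 : aconj (0 : A) = 0 by have := aconj_real (s := A) 0; rewrite scale0r.
by have := aconj_linear (-1) a 0; rewrite !addr0 c0 addr0 !scaleN1r.
Qed.

Lemma pseudosphereN a : pseudosphere a -> pseudosphere (- a).
Proof.
by case=> a0 a1; split; rewrite aconjN ?amulNl ?amulNr ?opprK // -opprD a0 oppr0.
Qed.

Lemma pseudosphere_sqr a : pseudosphere a -> amul a a = - aone.
Proof.
case=> /eqP; rewrite addrC addr_eq0 => /eqP a0; rewrite a0 amulNr => /eqP.
by rewrite eqr_oppLR => /eqP.
Qed.

Lemma pseudosphere_mulK a b : pseudosphere a -> amul a (amul a b) = - b.
Proof. by move=> /pseudosphere_sqr aa; rewrite amul_altl aa amulNl amul1l. Qed.

End AltStarAlgebra.

Section ComplexScaling.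
Context {R : realType} {A : altStarAlgType R}.

HB.instance Definition _ := GRing.Zmodule.copy (complexification A) (A * A)%type.

Definition cscale (c : R[i]) (u : complexification A) : complexification A :=
  (complex.Re c *: u.1 - complex.Im c *: u.2, complex.Re c *: u.2 + complex.Im c *: u.1).

Lemma cscaleA (c d : R[i]) u : cscale c (cscale d u) = cscale (c * d) u.
Proof.
case: c d u => [c1 c2] [d1 d2] [a b]; rewrite /cscale /=; congr (_, _).
  rewrite !scalerBr !scalerDr !scalerA !scalerBl !scalerDl.
  by rewrite !opprD [LHS](AC (2*2) ((1*4)*(2*3)))%AC.
rewrite !scalerBr !scalerDr !scalerA !scalerBl !scalerDl.
by rewrite [LHS](AC (2*2) ((1*4)*(2*3)))%AC.
Qed.

Lemma cscale1 : left_id 1 cscale.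
Proof. by move=> [a b]; rewrite /cscale /= !scale1r !scale0r subr0 addr0. Qed.

Lemma cscaleDr : right_distributive cscale +%R.
Proof.
move=> c [a b] [a' b']; rewrite /cscale /=; congr (_, _) => /=; rewrite !scalerDr.
  by rewrite opprD addrACA.
by rewrite addrACA.
Qed.

Lemma cscaleDl (u : complexification A) : {morph cscale^~ u : c d / c + d}.
Proof.
move=> c d; rewrite /cscale (raddfD (@complex.Re R)) (raddfD (@complex.Im R)) !scalerDl.
by congr (_, _) => /=; rewrite ?opprD addrACA.
Qed.

HB.instance Definition _ := GRing.Zmodule_isLmodule.Build R[i] (complexification A)
  cscaleA cscale1 cscaleDr cscaleDl.

Implicit Types (u v w : complexification A) (c : R[i]).

Lemma cmulDl u v w : cmul (u + v) w = cmul u w + cmul v w.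
Proof.
case: u v w => [a b] [a' b'] [c d]; rewrite /cmul /= !amulDl.
by congr (_, _) => /=; rewrite ?opprD addrACA.
Qed.

Lemma cmulDr u v w : cmul u (v + w) = cmul u v + cmul u w.
Proof.
case: v w u => [a b] [a' b'] [c d]; rewrite /cmul /= !amulDr.
by congr (_, _) => /=; rewrite ?opprD addrACA.
Qed.

Lemma cmulZl c u v : cmul (c *: u) v = c *: cmul u v.
Proof.
case: c u v => [x y] [a b] [a' b']; rewrite /cmul /=.
rewrite !amulDl !amulNl !amulZl.
congr (_, _) => /=; rewrite !scalerDr ?scalerN ?opprD.
  by rewrite (AC (2*2) ((1*3)*(4*2)))%AC.
by rewrite (AC (2*2) ((1*3)*(4*2)))%AC.
Qed.

Lemma cmulZr c u v : cmul u (c *: v) = c *: cmul u v.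
Proof.
case: c u v => [x y] [a b] [a' b']; rewrite /cmul /=.
rewrite !amulDr !amulNr !amulZr.
congr (_, _) => /=; rewrite !scalerDr ?scalerN ?opprD.
  by rewrite (AC (2*2) ((1*3)*(2*4)))%AC.
by rewrite (AC (2*2) ((1*3)*(2*4)))%AC.
Qed.

Lemma cmul1l u : cmul cone u = u.
Proof. by case: u => a b; rewrite /cmul /= !amul1l !amul0l subr0 addr0. Qed.

Lemma cmul1r u : cmul u cone = u.
Proof. by case: u => a b; rewrite /cmul /= !amul1r !amul0r subr0 add0r. Qed.

Lemma cmul0l u : cmul 0 u = 0.
Proof. by apply: (addIr (cmul 0 u)); rewrite -cmulDl !add0r. Qed.

Lemma cmul0r u : cmul u 0 = 0.
Proof. by apply: (addIr (cmul u 0)); rewrite -cmulDr !add0r. Qed.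

Lemma cmulNl u v : cmul (- u) v = - cmul u v.
Proof. by rewrite -scaleN1r cmulZl scaleN1r. Qed.

Lemma cmulNr u v : cmul u (- v) = - cmul u v.
Proof. by rewrite -scaleN1r cmulZr scaleN1r. Qed.

Lemma cmul_altl u v : cmul u (cmul u v) = cmul (cmul u u) v.
Proof.
have lin := alternative_linearl (@amulDl R A) (@amulDr R A) (@amul_altl R A).
case: u v => [a b] [c d]; rewrite /cmul /=.
rewrite !amulDr !amulNr [amul (_ - _) c]amulDl [amul (_ - _) d]amulDl !amulNl -!lin !amul_altl.
by congr (_, _) => /=; rewrite ?opprD (AC (2*2) ((1*4)*(2*3)))%AC.
Qed.

Lemma cmul_altr u v : cmul u (cmul v v) = cmul (cmul u v) v.
Proof.
have lin := alternative_linearr (@amulDl R A) (@amulDr R A) (@amul_altr R A).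
case: u v => [a b] [c d]; rewrite /cmul /=.
rewrite !amulDl !amulNl [amul a (_ - _)]amulDr [amul b (_ - _)]amulDr !amulNr -!lin !amul_altr.
by congr (_, _) => /=; rewrite ?opprD (AC (2*2) ((1*4)*(2*3)))%AC.
Qed.

Definition cmul_flexible := flexible cmulDl cmulDr cmul_altl cmul_altr.
Definition cmul_moufangr := moufangr cmulDl cmulDr cmul_altl cmul_altr.

Definition creal (a : A) : complexification A := (a, 0).

Lemma creal_sqr (I : A) : pseudosphere I -> cmul (creal I) (creal I) = - cone.
Proof.
move=> /pseudosphere_sqr II; rewrite /cmul /creal /= II !amul0r amul0l subr0 addr0.
by rewrite /cone; congr (_, _); rewrite oppr0.
Qed.

Lemma elementary_mulK (I : A) u (c d : R[i]) : pseudosphere I ->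
  cmul (cmul u (c *: cone + d *: creal I)) (c *: cone - d *: creal I) = (c ^+ 2 + d ^+ 2) *: u.
Proof.
move=> SI.
rewrite !cmulDr !cmulNr !cmulZr !cmul1r cmulDl !cmulZl -cmul_altr creal_sqr // cmulNr cmul1r.
rewrite !scalerDr !scalerA [d * c]mulrC scalerN opprD opprK addrA addrK.
by rewrite -scalerDl -!expr2.
Qed.

Lemma elementary_sqr (I : A) (c d : R[i]) : pseudosphere I ->
  cmul (c *: cone + d *: creal I) (c *: cone + d *: creal I)
    = (c ^+ 2 - d ^+ 2) *: cone + (c * d *+ 2) *: creal I.
Proof.
move=> SI; rewrite !(cmulDr, cmulDl, cmulZl, cmulZr) !cmul1l cmul1r creal_sqr //.
rewrite !scalerDr !scalerN !scalerA -!expr2 scalerBl mulr2n scalerDl [d * c]mulrC.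
by rewrite (AC (2*2) ((1*4)*(2*3)))%AC.
Qed.

(** [(1 - i I) (a + i b) = (a + I b) + i (b - I a)], and [b - I a = - I (a + I b)]. *)
Lemma zero_divisor_of_zero (I a b : A) : pseudosphere I -> a + amul I b = 0 ->
  cmul (aone, - I) (a, b) = 0.
Proof.
move=> SI /eqP; rewrite addr_eq0 => /eqP ->.
rewrite /cmul /= !amul1l !amulNl amulNr !pseudosphere_mulK // opprK.
by rewrite !opprK addNr subrr.
Qed.

End ComplexScaling.

(** * Complex coordinates and norm on the complexification *)

Section ComplexCoordinates.
Context {R : realType} {A : altStarAlgType R}.
Implicit Types (u v w : complexification A) (c : R[i]).
Local Notation n := (\dim {:A}).
Local Notation b := (vbasis {:A}).

Lemma ccoordD (j : 'I_n) u v : ccoord j (u + v) = ccoord j u + ccoord j v.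
Proof. by case: u v => [x y] [x' y']; rewrite /ccoord /= !linearD. Qed.

Lemma ccoordZ (j : 'I_n) c u : ccoord j (c *: u) = c * ccoord j u.
Proof.
case: c u => [p q] [x y]; rewrite /ccoord /= !linearD !linearN !linearZ /=.
by rewrite scalerN.
Qed.

Lemma ccoordB (j : 'I_n) u v : ccoord j (u - v) = ccoord j u - ccoord j v.
Proof. by rewrite ccoordD -scaleN1r ccoordZ mulN1r. Qed.

Lemma ccoord0 (j : 'I_n) : ccoord j (0 : complexification A) = 0.
Proof. by rewrite -(subrr 0) ccoordB subrr. Qed.

Lemma ccoord_sum (I : Type) (r : seq I) (Q : pred I) (F : I -> complexification A) (j : 'I_n) :
  ccoord j (\sum_(i <- r | Q i) F i) = \sum_(i <- r | Q i) ccoord j (F i).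
Proof. by apply: (big_morph (ccoord j)); [exact: ccoordD | exact: ccoord0]. Qed.

Lemma ccoord_inj u v : (forall j : 'I_n, ccoord j u = ccoord j v) -> u = v.
Proof.
case: u v => [x y] [x' y'] h.
have E (a a' : A) : (forall j, coord b j a = coord b j a') -> a = a'.
  move=> aa; rewrite (coord_vbasis (memvf a)) (coord_vbasis (memvf a')).
  by apply: eq_bigr => j _; rewrite aa.
by congr (_, _); apply: E => j; case: (h j).
Qed.

Lemma ccoord_cconj (j : 'I_n) u : ccoord j (cconj u) = (ccoord j u)^*%C.
Proof. by case: u => x y; rewrite /ccoord /= linearN. Qed.

Lemma coord_vbasis_tnth (i j : 'I_n) : coord b j b`_i = (i == j)%:R :> R.
Proof. by rewrite coord_free 1?eq_sym // (basis_free (vbasisP _)). Qed.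

Lemma ccoord_basis (i j : 'I_n) : ccoord j (creal b`_i : complexification A) = (i == j)%:R.
Proof.
rewrite /ccoord /creal /= coord_vbasis_tnth linear0.
by case: eqP => _; rewrite ?mulr1n ?mulr0n.
Qed.

Lemma ex_of_ccoord (f : 'I_n -> R[i]) :
  exists u : complexification A, forall j, ccoord j u = f j.
Proof.
exists (\sum_i f i *: creal b`_i) => j.
rewrite ccoord_sum (bigD1 j) //= big1 ?addr0 => [|i ij]; rewrite ccoordZ ccoord_basis.
  by rewrite eqxx mulr1.
by rewrite (negPf ij) mulr0.
Qed.

Lemma ccoord_sumE u : u = \sum_i ccoord i u *: creal b`_i.
Proof.
apply: ccoord_inj => j.
rewrite ccoord_sum (bigD1 j) //= big1 ?addr0 => [|i ij]; rewrite ccoordZ ccoord_basis.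
  by rewrite eqxx mulr1.
by rewrite (negPf ij) mulr0.
Qed.

Lemma cmul_suml (I : Type) (r : seq I) (Q : pred I) (F : I -> complexification A) v :
  cmul (\sum_(i <- r | Q i) F i) v = \sum_(i <- r | Q i) cmul (F i) v.
Proof.
apply: (big_morph (cmul^~ v)) => [x y|]; [exact: cmulDl | exact: cmul0l].
Qed.

Lemma cmul_sumr (I : Type) (r : seq I) (Q : pred I) (F : I -> complexification A) v :
  cmul v (\sum_(i <- r | Q i) F i) = \sum_(i <- r | Q i) cmul v (F i).
Proof.
apply: (big_morph (cmul v)) => [x y|]; [exact: cmulDr | exact: cmul0r].
Qed.

Definition struct_const (i k j : 'I_n) : R[i] :=
  ccoord j (cmul (creal b`_i) (creal b`_k) : complexification A).

Lemma ccoord_mul (j : 'I_n) u v :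
  ccoord j (cmul u v) = \sum_i \sum_k ccoord i u * ccoord k v * struct_const i k j.
Proof.
rewrite {1}(ccoord_sumE u) {1}(ccoord_sumE v) cmul_suml ccoord_sum.
apply: eq_bigr => i _; rewrite cmul_sumr ccoord_sum; apply: eq_bigr => k _.
by rewrite cmulZl cmulZr !ccoordZ mulrA.
Qed.

Definition anorm u : R := \sum_j cabs (ccoord j u).

Lemma anorm_ge0 u : 0 <= anorm u.
Proof. by apply: sumr_ge0 => j _; exact: cabs_ge0. Qed.

Lemma ccoord_le_anorm (j : 'I_n) u : cabs (ccoord j u) <= anorm u.
Proof.
by rewrite /anorm (bigD1 j) //= lerDl sumr_ge0 // => i _; exact: cabs_ge0.
Qed.

Lemma anormD u v : anorm (u + v) <= anorm u + anorm v.
Proof.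
by rewrite -big_split /=; apply: ler_sum => j _; rewrite ccoordD cabsD.
Qed.

Lemma anormZ c u : anorm (c *: u) = cabs c * anorm u.
Proof. by rewrite mulr_sumr; apply: eq_bigr => j _; rewrite ccoordZ cabsM. Qed.

Lemma anormN u : anorm (- u) = anorm u.
Proof. by rewrite -scaleN1r anormZ cabsN cabs1 mul1r. Qed.

Lemma anormB u v : anorm (u - v) = anorm (v - u).
Proof. by rewrite -anormN opprB. Qed.

Lemma anorm0 : anorm 0 = 0.
Proof. by rewrite -(scale0r 0) anormZ cabs0 mul0r. Qed.

Lemma anorm_eq0 u : anorm u <= 0 -> u = 0.
Proof.
move=> h; apply: ccoord_inj => j; rewrite ccoord0.
by apply: cabs_small_eq0 => e e0; apply: le_trans (ccoord_le_anorm j u) (le_trans h (ltW e0)).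
Qed.

Lemma ex_anormM : exists2 C : R, 1 <= C & forall u v, anorm (cmul u v) <= C * anorm u * anorm v.
Proof.
exists (1 + \sum_j \sum_i \sum_k cabs (struct_const i k j)).
  by rewrite lerDl; do 3!apply: sumr_ge0 => ? _; exact: cabs_ge0.
move=> u v; apply: le_trans (_ : (\sum_j \sum_i \sum_k cabs (struct_const i k j)) * anorm u * anorm v <= _).
  rewrite -mulrA mulr_suml; apply: ler_sum => j _; rewrite ccoord_mul.
  apply: le_trans (cabs_sum _ _ _) _; rewrite mulr_suml; apply: ler_sum => i _.
  apply: le_trans (cabs_sum _ _ _) _; rewrite mulr_suml; apply: ler_sum => k _.
  rewrite !cabsM mulrC ler_wpM2l ?cabs_ge0 //.
  by rewrite ler_pM ?cabs_ge0 ?ccoord_le_anorm.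
by rewrite -!mulrA ler_wpM2r ?mulr_ge0 ?anorm_ge0 // lerDr.
Qed.

(** In an alternative algebra a one-sided cancellation property already gives a
    two-sided inverse: solve [v u = 1] by dimension count, and then
    [(u v - 1) u = u (v u) - u = 0] by the flexible law. *)
Lemma cinvertible_of_injr u : (forall v, cmul v u = 0 -> v = 0) -> cinvertible u.
Proof.
move=> inj.
pose L := fun v : (A * A)%type => (cmul v u : (A * A)%type).
have Llin : linear L.
  move=> r v w; rewrite /L.
  have -> : r *: v + w = (r%:C%C *: (v : complexification A) + (w : complexification A)).
    by rewrite /GRing.scale /= /cscale /= !scale0r subr0 addr0.
  rewrite cmulDl cmulZl; congr (_ + _).
  by rewrite /GRing.scale /= /cscale /= !scale0r subr0 addr0.
pose LL := GRing.isLinear.Build R _ _ _ L Llin.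
pose Lf : {linear (A * A)%type -> (A * A)%type} := HB.pack L LL.
have ker0 : lker (linfun Lf) == 0%VS.
  apply/lker0P => v w; rewrite !lfunE /= => h.
  apply/eqP; rewrite -subr_eq0; apply/eqP; apply: inj.
  by rewrite cmulDl cmulNl; apply/eqP; rewrite subr_eq0; apply/eqP.
have [v hv] : exists v, cmul v u = cone.
  have : (cone : (A * A)%type) \in limg (linfun Lf).
    rewrite (_ : limg _ = fullv) ?memvf //; apply/eqP; rewrite eqEdim subvf /=.
    by rewrite limg_dim_eq // (eqP ker0) capv0.
  by case/memv_imgP => v _ ->; exists v; rewrite lfunE.
exists v; split=> //; apply/eqP; rewrite -subr_eq0; apply/eqP; apply: inj.
by rewrite cmulDl cmulNl -cmul_flexible hv cmul1r cmul1l subrr.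
Qed.

End ComplexCoordinates.

(** * Infinite two-sided products *)

Section InfiniteProduct.
Context {R : realType} {A : altStarAlgType R}.
Local Notation AC := (complexification A).
Variable G : set R[i].
Hypothesis Gopen : forall z, G z -> exists2 r : R, 0 < r & forall w, cabs (w - z) < r -> G w.
Hypothesis Gconj : forall z, G z <-> G z^*%C.

Lemma cconj_mul (u v : AC) : cmul (cconj u) (cconj v) = cconj (cmul u v).
Proof.
case: u v => [a b] [c d]; rewrite /cmul /cconj /= !amulNr !amulNl opprK.
by rewrite opprD.
Qed.

Lemma cconj_cone : cconj (cone : AC) = cone.
Proof. by rewrite /cconj /cone /= oppr0. Qed.

Variable C : R.
Hypothesis C_ge1 : 1 <= C.
Hypothesis anormM : forall u v : AC, anorm (cmul u v) <= C * anorm u * anorm v.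

Let C_gt0 : 0 < C. Proof. exact: lt_le_trans C_ge1. Qed.

Lemma cmul_near1_sub (p e : AC) (t : R) : t <= 1 -> C * anorm (e - cone) <= t / 8 ->
  anorm (cmul e (cmul p e) - p) <= t / 2 * anorm p.
Proof.
move=> t1 he; set d := e - cone in he.
have eE : e = cone + d by rewrite /d addrC subrK.
have -> : cmul e (cmul p e) - p = cmul p d + cmul d p + cmul d (cmul p d).
  apply/eqP; rewrite subr_eq [eqbRHS]addrC eE cmulDl cmul1l !cmulDr !cmul1r.
  by rewrite !addrA.
have d0 := anorm_ge0 d; have p0 := anorm_ge0 p; have Cd0 := mulr_ge0 (ltW C_gt0) d0.
have t0 : 0 <= t by lra.
have h1 : anorm (cmul p d) <= t / 8 * anorm p.
  apply: le_trans (anormM _ _) _.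
  by rewrite -mulrA [anorm p * _]mulrC mulrA ler_wpM2r.
have h2 : anorm (cmul d p) <= t / 8 * anorm p.
  by apply: le_trans (anormM _ _) _; rewrite ler_wpM2r.
have h3 : anorm (cmul d (cmul p d)) <= t / 8 * anorm p.
  apply: le_trans (anormM _ _) _; apply: le_trans (_ : t / 8 * (t / 8 * anorm p) <= _).
    by rewrite ler_pM ?anorm_ge0.
  have h4 : 0 <= t / 8 * anorm p by rewrite mulr_ge0 //; lra.
  by rewrite ler_piMl //; lra.
apply: le_trans (anormD _ _) _; apply: le_trans (lerD (anormD _ _) (lexx _)) _.
have := mulr_ge0 t0 p0; lra.
Qed.

Lemma cmul_near1_ge (x e : AC) (t : R) : C * anorm (e - cone) <= t / 8 ->
  (1 - t / 8) * anorm x <= anorm (cmul x e).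
Proof.
move=> he; have -> : cmul x e = x + cmul x (e - cone).
  by rewrite cmulDr cmulNr cmul1r addrC subrK.
have h1 : anorm (cmul x (e - cone)) <= t / 8 * anorm x.
  apply: le_trans (anormM _ _) _.
  by rewrite -mulrA [anorm x * _]mulrC mulrA ler_wpM2r ?anorm_ge0.
have := anormD (x + cmul x (e - cone)) (- cmul x (e - cone)).
by rewrite addrK anormN; lra.
Qed.

(** Injectivity of right multiplication by [u], in a quantitative form that passes to the
    limit when [s] is kept away from [0]. *)
Definition right_expanding (s : R) (u : AC) := forall x, s * anorm x <= anorm (cmul x u).

(** Without associativity nothing controls right multiplication by [p e]; for [e (p e)]
    the right Moufang identity does. *)
Lemma right_expanding_sandwich s t (e p : AC) : 0 <= s -> 0 <= t ->
  right_expanding s p -> right_expanding t e ->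
  right_expanding (t * t * s) (cmul e (cmul p e)).
Proof.
move=> s0 t0 hp he x; rewrite cmul_moufangr.
apply: le_trans (he _); rewrite -!mulrA ler_wpM2l //.
by apply: le_trans (hp _); rewrite mulrCA ler_wpM2l.
Qed.

Variable e : nat -> R[i] -> AC.
Hypothesis e_hol : forall n j, hol G (fun z => ccoord j (e n z)).
Hypothesis e_conj : forall n z, e n z^*%C = cconj (e n z).
Hypothesis e_near1 : forall m, exists N, forall n z, (N <= n)%N -> exhaustion G m z ->
  C * anorm (e n z - cone) <= 4^-1 ^+ n / 8.

(** Each factor is placed on both sides, which is what the right Moufang identity can
    handle. *)
Fixpoint sandwich n (z : R[i]) : AC :=
  if n is n'.+1 then cmul (e n' z) (cmul (sandwich n' z) (e n' z)) else cone.

Lemma hol_mul (u v : R[i] -> AC) :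
  (forall j, hol G (fun z => ccoord j (u z))) -> (forall j, hol G (fun z => ccoord j (v z))) ->
  forall j, hol G (fun z => ccoord j (cmul (u z) (v z))).
Proof.
move=> hu hv j; rewrite (_ : (fun z => _) = (fun z => \sum_i \sum_k
    ccoord i (u z) * ccoord k (v z) * struct_const i k j)); last first.
  by apply/funext => z; rewrite ccoord_mul.
apply: hol_sum => i _; apply: hol_sum => k _; apply: holM; last exact: hol_cst.
exact: holM.
Qed.

Lemma sandwich_hol n j : hol G (fun z => ccoord j (sandwich n z)).
Proof.
elim: n j => [|n IH] j /=; first exact: hol_cst.
by apply: hol_mul => //; exact: hol_mul.
Qed.

Lemma sandwich_conj n z : sandwich n z^*%C = cconj (sandwich n z).
Proof.
elim: n => [|n IH] /=; first by rewrite cconj_cone.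
by rewrite e_conj IH !cconj_mul.
Qed.

Let quarter_le n : (4^-1 : R) ^+ n <= 1.
Proof. by rewrite exprn_ile1 //; lra. Qed.

Lemma sandwich_step n z : C * anorm (e n z - cone) <= 4^-1 ^+ n / 8 ->
  anorm (sandwich n.+1 z - sandwich n z) <= 4^-1 ^+ n / 2 * anorm (sandwich n z).
Proof. exact: cmul_near1_sub. Qed.

Lemma sandwich_growth N z :
  (forall n, (N <= n)%N -> C * anorm (e n z - cone) <= 4^-1 ^+ n / 8) ->
  forall n, (N <= n)%N -> anorm (sandwich n z) <= 2 ^+ n * anorm (sandwich N z).
Proof.
move=> h; elim=> [|n IH].
  by rewrite leqn0 => /eqP ->; rewrite mul1r.
rewrite leq_eqVlt => /orP[/eqP <-|Nn].
  by rewrite ler_peMl ?anorm_ge0 // exprn_ege1 // ler1n.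
rewrite -(subrK (sandwich n z) (sandwich n.+1 z)) (le_trans (anormD _ _)) //.
have := sandwich_step (h n Nn); have := IH Nn; rewrite exprS.
have q1 := quarter_le n; have a0 := anorm_ge0 (sandwich n z).
have : 4^-1 ^+ n / 2 * anorm (sandwich n z) <= 2^-1 * anorm (sandwich n z).
  by rewrite ler_wpM2r //; lra.
by move=> h1 h2 h3; lra.
Qed.

Lemma sandwich_geometric N z (M : R) :
  (forall n, (N <= n)%N -> C * anorm (e n z - cone) <= 4^-1 ^+ n / 8) ->
  anorm (sandwich N z) <= M ->
  forall n, (N <= n)%N -> anorm (sandwich n.+1 z - sandwich n z) <= M * 2^-1 ^+ n.
Proof.
move=> h hM n Nn; apply: le_trans (sandwich_step (h n Nn)) _.
have a0 := anorm_ge0 (sandwich n z).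
have h0 : 0 <= (2^-1 : R) ^+ n by rewrite exprn_ge0.
have h4 : 0 <= (4^-1 : R) ^+ n by rewrite exprn_ge0.
apply: le_trans (_ : 4^-1 ^+ n * (2 ^+ n * M) <= _).
  apply: ler_pM; [by lra | exact: a0 | by lra | ].
  apply: le_trans (sandwich_growth h Nn) _.
  by rewrite ler_wpM2l // exprn_ge0.
have q2 : (4^-1 : R) ^+ n * 2 ^+ n = 2^-1 ^+ n by rewrite -exprMn; congr (_ ^+ n); field.
by rewrite mulrA q2 mulrC.
Qed.

(** The surplus [2 ^ - k.+1] over [1 / 2] absorbs the losses of the successive factors,
    which decrease like [4 ^ - k]. *)
Lemma right_expanding_sandwich_eventually N z s :
  (forall n, (N <= n)%N -> C * anorm (e n z - cone) <= 4^-1 ^+ n / 8) ->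
  0 <= s -> right_expanding s (sandwich N z) ->
  forall k, right_expanding (s * (2^-1 + 2^-1 ^+ k.+1)) (sandwich (N + k) z).
Proof.
move=> h s0 hs; elim=> [|k IH].
  by rewrite addn0 expr1 (_ : 2^-1 + 2^-1 = 1) ?mulr1 //; field.
rewrite addnS /=; set n := (N + k)%N in IH *.
have Nn : (N <= n)%N by rewrite leq_addr.
pose t : R := 1 - 4^-1 ^+ n / 8.
have q0 : 0 <= (4^-1 : R) ^+ n by rewrite exprn_ge0.
have q1 := quarter_le n.
have t0 : 0 <= t by rewrite /t; lra.
have he : right_expanding t (e n z) by move=> x; apply: cmul_near1_ge; exact: h.
have a0 : 0 <= (2^-1 : R) ^+ k.+1 by rewrite exprn_ge0.
have s1 : 0 <= s * (2^-1 + 2^-1 ^+ k.+1) by rewrite mulr_ge0 //; lra.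
move=> x; apply: le_trans (right_expanding_sandwich s1 t0 IH he x).
rewrite ler_wpM2r ?anorm_ge0 // mulrCA ler_wpM2l //.
have qk : 4^-1 ^+ n <= (2^-1 : R) ^+ k.
  apply: le_trans (_ : 4^-1 ^+ k <= _).
    by rewrite ler_wiXn2l ?leq_addl //; lra.
  by rewrite lerXn2r ?nnegrE //; lra.
have a1 : (2^-1 : R) ^+ k.+1 <= 2^-1 by rewrite exprS ler_piMr // exprn_ile1 //; lra.
have tt : 1 - 4^-1 ^+ n / 4 <= t * t.
  by rewrite /t; have := sqr_ge0 ((4^-1 : R) ^+ n / 8); rewrite expr2; lra.
apply: le_trans (_ : (1 - 4^-1 ^+ n / 4) * (2^-1 + 2^-1 ^+ k.+1) <= _); last first.
  by rewrite ler_wpM2r //; lra.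
have : 4^-1 ^+ n / 4 * (2^-1 + 2^-1 ^+ k.+1) <= 4^-1 ^+ n / 4 :> R.
  by apply: ler_piMr; lra.
by move: qk a1 a0; rewrite (exprS _ k.+1) (exprS _ k); lra.
Qed.

(** Where all factors but one equal [1] the partial products are eventually constant; where
    all factors are right expanding, the losses due to the late factors have a convergent
    sum. *)
Lemma infinite_sandwich : exists F : R[i] -> AC, [/\
  forall j, hol G (fun z => ccoord j (F z)),
  forall z, G z -> F z^*%C = cconj (F z),
  forall z, G z -> (forall n, exists2 s : R, 0 < s & right_expanding s (e n z)) ->
    forall v, cmul v (F z) = 0 -> v = 0
  & forall z n, G z -> (forall k, k <> n -> e k z = cone) -> F z = cmul (e n z) (e n z)].
Proof.
have geo j z (r r' : R) : 0 <= r -> r < r' -> (forall w, cabs (w - z) < r' -> G w) ->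
    exists N (d : R), forall n w, (N <= n)%N -> cdisc z r w ->
      cabs (ccoord j (sandwich n.+1 w) - ccoord j (sandwich n w)) <= d * 2^-1 ^+ n.
  move=> r0 rr zG; have [m Km] := cdisc_exhaustion rr zG; have [N hN] := e_near1 m.
  have /choice[M hM] : forall i : 'I_(\dim {:A}), exists M : R,
      forall w, cdisc z r w -> cabs (ccoord i (sandwich N w)) <= M.
    move=> i; have [M _ h] := papx_bounded (cdisc_bounded z r) (sandwich_hol N i r0 rr zG).
    by exists M.
  exists N, (\sum_i M i) => n w Nn zw; rewrite -ccoordB.
  apply: le_trans (ccoord_le_anorm _ _) _.
  apply: (sandwich_geometric (N := N)) => //; first by move=> k Nk; apply: hN => //; exact: Km.
  by apply: ler_sum => i _; exact: hM.
have /choice[f hf] : forall j : 'I_(\dim {:A}), exists f, hol G f /\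
    forall z N (d : R), G z ->
    (forall n, (N <= n)%N -> cabs (ccoord j (sandwich n.+1 z) - ccoord j (sandwich n z)) <= d * 2^-1 ^+ n) ->
    forall n, (N <= n)%N -> cabs (ccoord j (sandwich n z) - f z) <= 4 * d * 2^-1 ^+ n.
  move=> j; have [f fh fl] := hol_geometric_lim Gopen (fun n => sandwich_hol n j) (geo j).
  by exists f.
have /choice[F hF] : forall z, exists u : AC, forall j, ccoord j u = f j z.
  by move=> z; exact: ex_of_ccoord.
have near1 z : G z -> exists N, forall n, (N <= n)%N -> C * anorm (e n z - cone) <= 4^-1 ^+ n / 8.
  move=> /(ex_exhaustion Gopen)[m Kz]; have [N hN] := e_near1 m.
  by exists N => n Nn; exact: hN.
have Flim z (x : R) : G z -> 0 < x -> exists N, forall n, (N <= n)%N -> anorm (sandwich n z - F z) <= x.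
  move=> Gz x0; have [N hN] := near1 z Gz.
  pose M := anorm (sandwich N z).
  pose D : R := (\dim {:A})%:R * (4 * M) + 1.
  have D0 : 0 < D by rewrite ltr_wpDl // mulr_ge0 // mulr_ge0 // anorm_ge0.
  have [n0 hn0] := pow_half_small (divr_gt0 x0 D0).
  exists (maxn n0 N) => n; rewrite geq_max => /andP[/hn0 nx Nn].
  apply: le_trans (_ : D * 2^-1 ^+ n <= _); last by move: nx; rewrite ler_pdivlMr // mulrC.
  apply: le_trans (_ : \sum_(j < \dim {:A}) 4 * M * 2^-1 ^+ n <= _).
    apply: ler_sum => j _; rewrite ccoordB hF; have [_ h] := hf j.
    apply: (h z N) => // k Nk; rewrite -ccoordB.
    apply: le_trans (ccoord_le_anorm _ _) _.
    exact: (sandwich_geometric hN).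
  rewrite sumr_const card_ord -[leLHS]mulr_natl /D [leLHS]mulrA ler_wpM2r ?exprn_ge0 //.
  by rewrite lerDl.
have uniq_small (u v : AC) : (forall x : R, 0 < x -> anorm (u - v) <= x) -> u = v.
  move=> h; apply/eqP; rewrite -subr_eq0; apply/eqP/anorm_eq0.
  by apply/ler_addgt0Pl => x x0; rewrite addr0 h.
exists F; split.
- move=> j; rewrite (_ : (fun z => _) = f j); first by case: (hf j).
  by apply/funext => z.
- move=> z Gz; apply: uniq_small => x x0; have x2 : 0 < x / 2 by rewrite divr_gt0.
  have [N1 h1] := Flim z _ Gz x2; have [N2 h2] := Flim _ _ (proj1 (Gconj z) Gz) x2.
  pose n := maxn N1 N2.
  have k1 := h1 n (leq_maxl _ _); have k2 := h2 n (leq_maxr _ _).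
  have cc (u : AC) : anorm (cconj u) = anorm u.
    by apply: eq_bigr => j _; rewrite ccoord_cconj cabsJ.
  rewrite -(subrKA (sandwich n z^*%C)) (le_trans (anormD _ _)) // [leRHS]splitr lerD //.
    by rewrite anormB.
  rewrite sandwich_conj (_ : cconj _ - cconj _ = cconj (sandwich n z - F z)) ?cc //.
  by rewrite /cconj; congr (_, _); rewrite /= opprD.
- move=> z Gz hexp v vF; have [N hN] := near1 z Gz.
  have [s s0 hs] : exists2 s : R, 0 < s & right_expanding s (sandwich N z).
    elim: N {hN} => [|n [s s0 hs]].
      by exists 1 => // x; rewrite cmul1r mul1r.
    have [t t0 ht] := hexp n; exists (t * t * s); first by rewrite !mulr_gt0.
    by apply: right_expanding_sandwich => //; exact: ltW.
  have low := right_expanding_sandwich_eventually hN (ltW s0) hs.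
  apply: anorm_eq0; apply/ler_addgt0Pl => x x0; rewrite addr0.
  pose D : R := C * anorm v + 1.
  have D0 : 0 < D by rewrite ltr_wpDl // mulr_ge0 ?anorm_ge0 // ltW.
  have sx : 0 < s * x / 2 by rewrite divr_gt0 // mulr_gt0.
  have [N1 h1] := Flim z _ Gz (divr_gt0 sx D0).
  have {}h1 := h1 (N + N1)%N (leq_addl _ _); have {}low := low N1 v.
  have vS : cmul v (sandwich (N + N1) z) = cmul v (sandwich (N + N1) z - F z).
    by rewrite cmulDr cmulNr vF subr0.
  have up : anorm (cmul v (sandwich (N + N1) z)) <= s * x / 2.
    rewrite vS; apply: le_trans (anormM _ _) _.
    move: h1; rewrite ler_pdivlMr // mulrC; apply: le_trans.
    by rewrite ler_wpM2r ?anorm_ge0 // lerDl.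
  have := le_trans low up.
  have : s * anorm v * 2^-1 <= s * (2^-1 + 2^-1 ^+ N1.+1) * anorm v.
    rewrite mulrAC -!mulrA ler_pM2l // ler_wpM2r ?anorm_ge0 // lerDl.
    by rewrite exprn_ge0.
  move=> h2 h3; have : s * anorm v <= s * x by lra.
  by rewrite ler_pM2l.
move=> z n Gz hk.
have one k : (k <= n)%N -> sandwich k z = cone.
  elim: k => [//|k IH] kn /=; rewrite hk; last by move=> kE; rewrite kE ltnn in kn.
  by rewrite cmul1l cmul1r IH // ltnW.
have sq k : (n < k)%N -> sandwich k z = cmul (e n z) (e n z).
  elim: k => [//|k IH]; rewrite ltnS leq_eqVlt => /orP[/eqP <-|nk] /=.
    by rewrite one // cmul1l.
  rewrite IH // hk ?cmul1l ?cmul1r // => kE; by rewrite kE ltnn in nk.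
apply: uniq_small => x x0; have [N hN] := Flim z x Gz x0.
have := hN (maxn N n.+1) (leq_maxl _ _); rewrite sq ?leq_max ?ltnSn ?orbT //.
by rewrite anormB.
Qed.

End InfiniteProduct.

(** * Finiteness of a discrete set inside the exhaustion *)

Section DiscreteSets.
Context {R : realType}.
Implicit Types (G E : set R[i]) (z w : R[i]).

Lemma open_cdisc G z : open G -> G z ->
  exists2 r : R, 0 < r & forall w, cabs (w - z) < r -> G w.
Proof.
rewrite openE => Go /Go /nbhs_ballP[e /= e0 eG].
have eE : e = (complex.Re e)%:C%C by rewrite RRe_real // ger0_real // ltW.
exists (complex.Re e); first by rewrite -ltcR -eE.
move=> w wz; apply: eG; rewrite -ball_normE /=.
by rewrite distrC normCabs eE ltcR.
Qed.

Lemma complex_bolzano_weierstrass (u : nat -> R[i]) (M : R) :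
    (forall n, cabs (u n) <= M) ->
  exists f l, [/\ injective f & forall e : R, 0 < e ->
    exists N : nat, forall n, (N <= n)%N -> cabs (u (f n) - l) <= e].
Proof.
move=> hM.
have bnd (v : nat -> R) : (forall n, `|v n| <= M) -> bounded_fun v.
  move=> h; exists M; split; first exact: num_real.
  by move=> x Mx n _; apply: le_trans (h n) (ltW Mx).
have [f fi /cvg_ex[a fa]] := bolzano_weierstrass (bnd (fun n => complex.Re (u n))
  (fun n => le_trans (normRe_le _) (hM n))).
have [g gi /cvg_ex[b gb]] := bolzano_weierstrass (bnd (fun n => complex.Im (u (f n)))
  (fun n => le_trans (normIm_le _) (hM _))).
have inj h : increasing_seq h -> injective h.
  move=> hi m n mn; have := hi m n; have := hi n m; rewrite mn !lexx => /esym nm /esym mn'.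
  by apply/eqP; rewrite eqn_leq; apply/andP.
exists (f \o g), (a +i* b)%C; split; first by apply: inj_comp; exact: inj.
move=> e e0; have e2 : 0 < e / 2 by rewrite divr_gt0.
have /cvgrPdist_le/(_ _ e2)[N1 _ h1] := fa; have /cvgrPdist_le/(_ _ e2)[N2 _ h2] := gb.
have gn n : (n <= g n)%N.
  elim: n => [//|n IH]; apply: leq_ltn_trans IH _.
  by rewrite ltnNge; have := gi n.+1 n; rewrite !leEnat ltnn => ->.
exists (maxn N1 N2) => n; rewrite geq_max => /andP[n1 n2].
apply: le_trans (cabs_leReIm _) _; rewrite [leRHS]splitr /=.
have k1 := h1 (g n) (leq_trans n1 (gn n)); have k2 := h2 n n2.
rewrite distrC in k1; rewrite distrC in k2.
by apply: lerD; move: k1 k2 => /=; case: (u (f (g n))).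
Qed.

(** By the Bolzano-Weierstrass theorem; the conditions defining [exhaustion G n] and the
    closed upper half-plane pass to the accumulation point. *)
Lemma finite_exhaustion G E n : E `<=` [set z | 0 <= complex.Im z] ->
    (forall z, upper_part G z -> ~ limit_point E z) ->
  finite_set (E `&` exhaustion G n).
Proof.
move=> Eup Elim; apply: contrapT => /infiniteP/pcard_leP/unsquash u.
have uE k : (E `&` exhaustion G n) (u k) by exact: funS.
have [|f [l [fi fl]]] := @complex_bolzano_weierstrass u (100 ^+ n).
  by move=> k; have [_ []] := uE k.
have far (b : R[i]) (c : R) : (forall k, c <= cabs (u k - b)) -> c <= cabs (l - b).
  move=> h; apply/ler_addgt0Pr => e /fl[N /(_ N (leqnn N)) hN].
  apply: le_trans (h (f N)) _; apply: le_trans (cabs_dist _ l _) _.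
  by rewrite addrC lerD2l.
have Kl : exhaustion G n l.
  have [_ [n1 _ _]] := uE 0%N; split=> //.
    apply/ler_addgt0Pr => e /fl[N /(_ N (leqnn N)) hN].
    rewrite -(subrK (u (f N)) l) (le_trans (cabsD _ _)) // addrC lerD //.
      by have [_ []] := uE (f N).
    by rewrite cabsB.
  by move=> b Gb; apply: far => k; have [_ [_ _]] := uE k; exact.
apply: (Elim l).
  split; first exact: exhaustion_sub Kl.
  apply/ler_addgt0Pr => e /fl[N /(_ N (leqnn N)) hN].
  have [/Eup /= u0 _] := uE (f N).
  have := le_trans (normIm_le _) hN; rewrite ler_norml => /andP[_].
  by move: u0; case: (u (f N)) => a b; case: l {fl hN Kl far} => c d /=; lra.
move=> U /nbhs_ballP[e /= e0 eU].
have eE : e = (complex.Re e)%:C%C by rewrite RRe_real // ger0_real // ltW.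
have e0' : 0 < complex.Re e by rewrite -ltcR -eE.
have e2 : 0 < complex.Re e / 2 by rewrite divr_gt0.
have [N hN] := fl _ e2.
have inU k : (N <= k)%N -> U (u (f k)).
  move=> /hN hk; apply: eU; rewrite -ball_normE /= normCabs eE ltcR cabsB.
  by apply: le_lt_trans hk _; rewrite ltr_pdivrMr // ltr_pMr // ltr1n.
have [uN|uN] := eqVneq (u (f N)) l; last first.
  by exists (u (f N)); split=> //; [have [] := uE (f N) | exact: inU].
exists (u (f N.+1)); split; [|by have [] := uE (f N.+1) | by apply: inU].
have uinj a c : u a = u c -> a = c by apply: inj; exact: in_setT.
rewrite -uN; apply/eqP => /uinj/fi/eqP.
by rewrite -[X in X == _]addn1 -[X in _ == X]addn0 eqn_add2l.
Qed.

End DiscreteSets.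

(** * Stems with a single zero *)

Section ElementaryStem.
Context {R : realType} {A : altStarAlgType R}.
Local Notation AC := (complexification A).
Variable G : set R[i].
Hypothesis Gconj : forall z, G z <-> G z^*%C.
Variable C : R.
Hypothesis C_ge1 : 1 <= C.
Hypothesis anormM : forall u v : AC, anorm (cmul u v) <= C * anorm u * anorm v.

Lemma cconj_comb (c d : R[i]) (a : A) :
  cconj (c *: cone + d *: creal a) = c^*%C *: cone + d^*%C *: creal a.
Proof.
apply: ccoord_inj => j; rewrite ccoord_cconj !ccoordD !ccoordZ rmorphD !rmorphM.
have real (b : A) : (ccoord j (creal b))^*%C = ccoord j (creal b).
  by rewrite -ccoord_cconj /cconj /creal /= oppr0.
by congr (_ * _ + _ * _); exact: real.
Qed.

Variables (phi : R[i] -> R[i]) (p : R[i]) (k : nat) (d : R).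
Hypothesis Gp : G p.
Hypothesis phi_hol : hol G phi.
Hypothesis phi0 : forall z, G z -> phi z = 0 <-> z = p.
Hypothesis phi_near1 : forall z, exhaustion G k z -> cabs (phi z - 1) <= d.

(* The reflection of [phi], which vanishes only at the conjugate of [p]. *)
Let phic z := (phi z^*%C)^*%C.

Let phicc z : phic z^*%C = (phi z)^*%C. Proof. by rewrite /phic conjcK. Qed.

Let phic_hol : hol G phic. Proof. exact: hol_conj. Qed.

Let phic_near1 z : exhaustion G k z -> cabs (phic z - 1) <= d.
Proof.
move=> Kz; rewrite /phic -[1](conjc1 R) -rmorphB cabsJ.
by apply: phi_near1; exact: exhaustion_conj.
Qed.

Let phi_neq0 z : G z -> z <> p -> phi z != 0.
Proof. by move=> Gz zp; apply/eqP => /(phi0 Gz). Qed.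

Let phic_neq0 z : G z -> z <> p^*%C -> phic z != 0.
Proof.
move=> Gz zp; rewrite conjc_eq0; apply: phi_neq0; first exact: (proj1 (Gconj z)).
by move=> zE; apply: zp; rewrite -zE conjcK.
Qed.

(** A scalar stem: when it vanishes at [p], the induced function vanishes on the whole
    sphere through [p]. *)
Definition sphere_stem z : AC := (phi z * phic z) *: cone.

Lemma sphere_stem_hol j : hol G (fun z => ccoord j (sphere_stem z)).
Proof.
rewrite (_ : (fun z => _) = fun z => phi z * phic z * ccoord j (cone : AC)).
  by apply: holM; [exact: holM | exact: hol_cst].
by apply/funext => z; rewrite ccoordZ.
Qed.

Lemma sphere_stem_conj z : sphere_stem z^*%C = cconj (sphere_stem z).
Proof.
have := cconj_comb (phi z * phic z) 0 0; rewrite scale0r conjc0 scale0r !addr0 => ->.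
by rewrite /sphere_stem phicc [in RHS]mulrC rmorphM /= {1}/phic conjcK.
Qed.

Lemma sphere_stem_expanding z : G z -> z <> p -> z <> p^*%C ->
  exists2 s : R, 0 < s & right_expanding s (sphere_stem z).
Proof.
move=> Gz zp zpc; exists (cabs (phi z * phic z)).
  by rewrite cabs_gt0 mulf_neq0 ?phi_neq0 ?phic_neq0.
by move=> x; rewrite cmulZr cmul1r anormZ.
Qed.

Lemma sphere_stem1 z : phi z = 1 -> phi z^*%C = 1 -> sphere_stem z = cone.
Proof. by rewrite /sphere_stem /phic => -> ->; rewrite conjc1 mul1r scale1r. Qed.

Lemma sphere_stem_near1 z : d <= 1 -> exhaustion G k z ->
  anorm (sphere_stem z - cone) <= 3 * d * anorm (cone : AC).
Proof.
move=> d1 Kz; rewrite -[X in _ - X]scale1r -scalerBl anormZ ler_wpM2r ?anorm_ge0 //.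
have h1 := phi_near1 Kz; have h2 := phic_near1 Kz.
have -> : phi z * phic z - 1 = (phi z - 1) * (phic z - 1) + (phi z - 1) + (phic z - 1) by ring.
have := ler_pM (cabs_ge0 _) (cabs_ge0 _) h1 h2.
have d0 : 0 <= d by apply: le_trans h1; exact: cabs_ge0.
have : d * d <= d by rewrite ler_piMr.
move=> h3 h4; apply: le_trans (cabsD _ _) _; apply: le_trans (lerD (cabsD _ _) (lexx _)) _.
by rewrite cabsM; lra.
Qed.

Lemma sphere_stem0 : sphere_stem p = 0.
Proof. by rewrite /sphere_stem (proj2 (phi0 Gp)) // mul0r scale0r. Qed.

Variable I : A.
Hypothesis SI : pseudosphere I.

(** In the complex plane [C[I]], split by its idempotents [(1 -+ i I) / 2], this is the
    pair [(phi, phic)]; at [p] only the second component survives. *)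
Definition point_stem z : AC :=
  ((phi z + phic z) / 2) *: cone + ((phi z - phic z) / (2 * 'i%C)) *: creal I.

Let i2 : ('i%C : R[i]) * 'i%C = -1. Proof. by rewrite -expr2 sqr_i. Qed.

Let i_neq0 : ('i%C : R[i]) != 0.
Proof. by rewrite -cabs_gt0 cabsi. Qed.

Lemma point_stem_hol j : hol G (fun z => ccoord j (point_stem z)).
Proof.
rewrite (_ : (fun z => _) = fun z => (phi z + phic z) * 2^-1 * ccoord j (cone : AC)
   + (phi z - phic z) * (2 * 'i%C)^-1 * ccoord j (creal I)).
  by apply: holD; (apply: holM; last exact: hol_cst); (apply: holM; last exact: hol_cst);
    [exact: holD | exact: holB].
by apply/funext => z; rewrite ccoordD !ccoordZ.
Qed.

Lemma point_stem_conj z : point_stem z^*%C = cconj (point_stem z).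
Proof.
rewrite cconj_comb /point_stem phicc.
have cc : (phic z)^*%C = phi z^*%C by rewrite /phic conjcK.
have ci : ('i%C : R[i])^*%C = - 'i%C by apply/eqP; rewrite eq_complex /= oppr0 !eqxx.
have cM (x y : R[i]) : (x * y)^*%C = x^*%C * y^*%C by exact: rmorphM.
have cD (x y : R[i]) : (x + y)^*%C = x^*%C + y^*%C by exact: rmorphD.
have cB (x y : R[i]) : (x - y)^*%C = x^*%C - y^*%C by exact: rmorphB.
congr (_ *: _ + _ *: _); first by rewrite cM cD cc conjc_inv conjc_nat addrC.
rewrite cM cB cc conjc_inv cM ci conjc_nat.
by rewrite mulrN invrN mulrN -mulNr opprB.
Qed.

(** Up to the scalar [phi phic], the inverse of [c + b I] is [c - b I]. *)
Lemma point_stem_expanding z : G z -> z <> p -> z <> p^*%C ->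
  exists2 s : R, 0 < s & right_expanding s (point_stem z).
Proof.
move=> Gz zp zpc.
set c := (phi z + phic z) / 2; set b := (phi z - phic z) / (2 * 'i%C).
have cb : c ^+ 2 + b ^+ 2 = phi z * phic z.
  have -> : b = - ('i%C * ((phi z - phic z) / 2)).
    rewrite /b invfM -[('i%C : R[i])^-1]mul1r -[X in X / 'i%C]opprK -i2.
    by rewrite mulNr mulfK // mulrN mulrN; congr (- _); ring.
  by rewrite [X in _ + X]sqrrN [X in _ + X]exprMn sqr_i /c; field.
have Ce : 0 < C * anorm (c *: cone - b *: creal I) + 1.
  by rewrite ltr_wpDl // mulr_ge0 ?anorm_ge0 // (le_trans ler01).
exists (cabs (phi z * phic z) / (C * anorm (c *: cone - b *: creal I) + 1)).
  by rewrite divr_gt0 // cabs_gt0 mulf_neq0 ?phi_neq0 ?phic_neq0.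
move=> x; rewrite mulrAC ler_pdivrMr // -anormZ -cb -(elementary_mulK x c b SI).
apply: le_trans (anormM _ _) _.
rewrite mulrAC mulrC ler_wpM2l ?anorm_ge0 //.
by rewrite lerDl.
Qed.

Lemma point_stem1 z : phi z = 1 -> phi z^*%C = 1 -> point_stem z = cone.
Proof.
rewrite /point_stem /phic => -> ->; rewrite conjc1 subrr mul0r scale0r addr0.
by rewrite (_ : (1 + 1) / 2 = 1) ?scale1r //; field.
Qed.

Lemma point_stem_near1 z : exhaustion G k z ->
  anorm (point_stem z - cone) <= d * (anorm (cone : AC) + anorm (creal I)).
Proof.
move=> Kz; have h1 := phi_near1 Kz; have h2 := phic_near1 Kz.
have -> : point_stem z - cone = (((phi z - 1) + (phic z - 1)) / 2) *: cone
    + (((phi z - 1) - (phic z - 1)) / (2 * 'i%C)) *: creal I.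
  rewrite /point_stem addrAC -[X in _ - X + _]scale1r -scalerBl.
  congr (_ *: _ + _ *: _); first by field.
  by congr (_ / _); ring.
apply: le_trans (anormD _ _) _; rewrite !anormZ mulrDr.
apply: lerD; rewrite ler_wpM2r ?anorm_ge0 // cabsM cabsV ?cabsM ?cabsi ?mulr1 cabs_nat.
  by rewrite ler_pdivrMr //; apply: le_trans (cabsD _ _) _; lra.
by rewrite ler_pdivrMr //; apply: le_trans (cabsDB _ _) _; lra.
Qed.

(** At [p] the stem is a multiple of [1 + i I], twice an idempotent. *)
Lemma point_stem_sqr : p <> p^*%C -> exists2 c : R[i], c != 0 &
  cmul (point_stem p) (point_stem p) = c *: (cone + 'i%C *: creal I).
Proof.
move=> pp; have w0 := phic_neq0 Gp pp.
exists (phic p ^+ 2 / 2); first by rewrite mulf_neq0 ?invr_eq0 ?expf_neq0.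
rewrite elementary_sqr // (proj2 (phi0 Gp)) // add0r sub0r.
have -> : - phic p / (2 * 'i%C) = 'i%C * (phic p / 2).
  rewrite invfM -[('i%C : R[i])^-1]mul1r -[X in X / 'i%C]opprK -i2.
  by rewrite !mulNr mulfK // !mulrN; ring.
rewrite scalerDr scalerA; congr (_ *: _ + _ *: _).
  by rewrite [X in _ - X]exprMn sqr_i; field.
by rewrite mulr2n; field.
Qed.

End ElementaryStem.

(** * Points of the axial domain and their projections *)

Section SlicePoints.
Context {R : realType} {A : altStarAlgType R}.
Implicit Types (x y : R) (I J : A) (G : set R[i]) (D : set A).

Lemma slice_ptN x y I : slice_pt x (- y) (- I) = slice_pt x y I.
Proof. by rewrite /slice_pt scalerN scaleNr opprK. Qed.

Lemma slice_pt_neq_inj x y I J : y != 0 -> slice_pt x y I = slice_pt x y J -> I = J.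
Proof. by move=> y0 /addrI; exact: scalerI. Qed.

(** As [x + y I = x + (- y) (- I)], the closed upper half-plane suffices. *)
Lemma axial_domain_upper G (q : A) : (forall z, G z <-> G z^*%C) -> axial_domain G q ->
  exists x y I, [/\ 0 <= y, G (x +i* y)%C, pseudosphere I & q = slice_pt x y I].
Proof.
move=> Gc [x [y [I [Gz SI ->]]]]; have [y0|y0] := leP 0 y.
  by exists x, y, I.
exists x, (- y), (- I); rewrite slice_ptN oppr_ge0 (ltW y0); split=> //.
  by have /Gc := Gz.
exact: pseudosphereN.
Qed.

Lemma pi_image_upper D : pi_image D `<=` [set z | 0 <= complex.Im z].
Proof. by move=> z [x [y [I [_ _ ->]]]] /=. Qed.

Lemma pi_imageP D x y : 0 <= y ->
  pi_image D (x +i* y)%C <-> exists2 I, pseudosphere I & D (slice_pt x y I).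
Proof.
move=> y0; split=> [[x' [y' [I [SI DI [-> yE]]]]]|[I SI DI]]; last first.
  by exists x, y, I; rewrite ger0_norm.
rewrite yE; have [y'0|y'0] := leP 0 y'; first by exists I; rewrite ?ger0_norm.
by exists (- I); [exact: pseudosphereN | rewrite ltr0_norm // slice_ptN].
Qed.

Lemma pi_image_sub G D : (forall z, G z <-> G z^*%C) -> D `<=` axial_domain G ->
  pi_image D `<=` G.
Proof.
move=> Gc DG [x y] zD; have y0 : 0 <= y := pi_image_upper zD.
have [I SI /DG] := proj1 (pi_imageP D x y0) zD.
move=> /(axial_domain_upper Gc)[x' [y' [J [y'0 Gz SJ qE]]]].
have [-> ] := slice_pt_inj SI SJ qE.
by rewrite !ger0_norm // => ->.
Qed.

(** Two representations of a nonreal point differ at most by a simultaneous change of sign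
    of [y] and [I], which the symmetry of the stem compensates; at a real point the second
    component of the stem vanishes. *)
Lemma stem_value_eq G (F : R[i] -> complexification A) x y x' y' I J :
    (forall z, G z <-> G z^*%C) -> (forall z, G z -> F z^*%C = cconj (F z)) ->
    G (x +i* y)%C -> pseudosphere I -> pseudosphere J -> slice_pt x y I = slice_pt x' y' J ->
  (F (x +i* y)%C).1 + amul I (F (x +i* y)%C).2
    = (F (x' +i* y')%C).1 + amul J (F (x' +i* y')%C).2.
Proof.
move=> Gc Fc Gz SI SJ qE; have [xE /eqP] := slice_pt_inj SI SJ qE; subst x'.
have [y0|y0] := eqVneq y 0.
  rewrite y0 normr0 eq_sym normr_eq0 => /eqP ->; subst y.
  have : F (x +i* 0)%C = cconj (F (x +i* 0)%C).
    by rewrite -Fc //= oppr0.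
  case: (F _) => a b [] /eqP; rewrite -addr_eq0 -mulr2n -scaler_nat scaler_eq0 pnatr_eq0 /=.
  by move=> /eqP ->; rewrite !amul0r.
rewrite eqr_norm2 => /orP[]/eqP yE; subst y.
  by rewrite (slice_pt_neq_inj y0 qE).
have -> : (x +i* - y')%C = (x +i* y')%C^*%C by [].
have Gz' : G (x +i* y')%C by apply/Gc.
rewrite Fc // /cconj /= amulNr -amulNl; congr (_ + amul _ _).
move: qE; rewrite -(slice_ptN x y' J); move/(slice_pt_neq_inj y0) => ->.
by rewrite opprK.
Qed.

End SlicePoints.

(** * A stem with prescribed zeros *)

Section StemWithZeros.
Context {R : realType} {A : altStarAlgType R}.
Local Notation AC := (complexification A).
(** [kind z] is [None] when a whole sphere of zeros is wanted over [z], and [Some I] when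
    only the point over [I] is. *)
Variables (G Z : set R[i]) (kind : R[i] -> option A).
Hypothesis Gopen : forall z, G z -> exists2 r : R, 0 < r & forall w, cabs (w - z) < r -> G w.
Hypothesis Gconj : forall z, G z <-> G z^*%C.
Hypothesis ZG : Z `<=` G.
Hypothesis Zup : Z `<=` [set z | 0 <= complex.Im z].
Hypothesis Zfin : forall n, finite_set (Z `&` exhaustion G n).
Hypothesis kindP : forall z I, Z z -> kind z = Some I -> pseudosphere I /\ z <> z^*%C.

Let P : set R[i] := [set z | Z z \/ Z z^*%C].

Let PG : P `<=` G. Proof. by move=> z [/ZG//|/ZG/(proj2 (Gconj z))]. Qed.

Let Pfin n : finite_set (P `&` exhaustion G n).
Proof.
apply: (@sub_finite_set _ _ ((Z `&` exhaustion G n) `|` (@conjc R) @` (Z `&` exhaustion G n))).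
  move=> z [[Zz|Zz] Kz]; [by left | right; exists z^*%C; last by rewrite conjcK].
  by split=> //; exact: exhaustion_conj.
by rewrite finite_setU; split=> //; exact: finite_image.
Qed.

Let P_enum : exists f : R[i] -> nat, forall p q, P p -> P q -> f p = f q -> p = q.
Proof.
have : countable (\bigcup_n (P `&` exhaustion G n)).
  by apply: bigcup_countable => // n _; exact: finite_set_countable.
move=> /countable_injP[f finj]; exists f => p q Pp Pq.
have inU z : P z -> z \in \bigcup_n (P `&` exhaustion G n).
  by move=> Pz; rewrite in_setE; have [n Kz] := ex_exhaustion Gopen (PG Pz); exists n.
by apply: finj; exact: inU.
Qed.

Let Z_conj_eq p q : Z p -> Z q -> p = q^*%C -> p = q.
Proof.
move=> /Zup /= p0 /Zup /= + E; move: p0; rewrite {}E; case: q => x y /= h1 h2.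
by congr (_ +i* _)%C; lra.
Qed.

(** The two-sided product of one elementary stem per point of [Z]. Each factor equals [1]
    at all the other points of [Z] and at their conjugates, so that the value of the product
    at a point of [Z] is the square of one explicit element, whatever the bracketing. *)
Lemma ex_stem_with_zeros : exists F : R[i] -> AC, [/\
  forall j, hol G (fun z => ccoord j (F z)),
  forall z, G z -> F z^*%C = cconj (F z),
  forall z, G z -> ~ Z z -> ~ Z z^*%C -> forall v, cmul v (F z) = 0 -> v = 0,
  forall z, Z z -> kind z = None -> F z = 0
  & forall z I, Z z -> kind z = Some I ->
      exists2 c : R[i], c != 0 & F z = c *: (cone + 'i%C *: creal I)].
Proof.
have [C C1 CM] := @ex_anormM R A; have C0 : 0 < C by exact: lt_le_trans C1.
have [f finj] := P_enum; have [level [lev1 lev2 lev3]] := ex_level Gopen.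
have lev_proper j : exists N, forall p, P p -> (N <= f p)%N -> (j <= level p)%N.
  have /finite_seqP[s sE] := Pfin (j + 3).
  exists (\max_(p <- s) f p).+1 => p Pp fp; rewrite leqNgt; apply/negP => lp.
  have ps : p \in s.
    have : (P `&` exhaustion G (j + 3)) p by split=> //; apply: lev3 => //; exact: PG.
    by rewrite sE.
  by have := @leq_bigmax_seq _ s xpredT f p ps isT; rewrite leqNgt fp.
(* The accuracy under which the product of the factors converges. *)
pose t p : R := 4^-1 ^+ f p / 8 / C.
have t0 p : 0 < t p by rewrite !divr_gt0 // exprn_gt0.
have /choice[E hE] : forall p, exists e : R[i] -> AC, Z p -> [/\
    (forall j, hol G (fun z => ccoord j (e z))) /\ (forall z, e z^*%C = cconj (e z)),
    (forall z, G z -> z <> p -> z <> p^*%C -> exists2 s : R, 0 < s & right_expanding s (e z)),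
    (forall z, P z -> z <> p -> z <> p^*%C -> e z = cone),
    (forall z, exhaustion G (level p) z -> anorm (e z - cone) <= t p)
    & (kind p = None -> cmul (e p) (e p) = 0) /\ (forall I, kind p = Some I ->
      exists2 c : R[i], c != 0 & cmul (e p) (e p) = c *: (cone + 'i%C *: creal I))].
  move=> p; have [Zp|] := pselect (Z p); last by exists (fun=> 0).
  have Pp : P p by left.
  pose M := 3 * anorm (cone : AC) + if kind p is Some J then anorm (creal J) else 0.
  have M0 : 0 <= M.
    rewrite addr_ge0 ?mulr_ge0 ?anorm_ge0 //.
    by case: (kind p) => [I|]; rewrite ?anorm_ge0.
  have M1 : 0 < M + 1 by rewrite ltr_wpDl.
  pose d : R := Num.min 1 (t p / (M + 1)).
  have d0 : 0 < d by rewrite lt_min ltr01 divr_gt0.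
  have d1 : d <= 1 by rewrite ge_min lexx.
  have dM : d * M <= t p.
    apply: le_trans (_ : d * (M + 1) <= _); first by rewrite ler_pM2l // lerDl.
    by rewrite -ler_pdivlMr // ge_min lexx orbT.
  have [phi [phih phi0 phi1 phiK]] :=
    ex_elementary_factor Gopen PG Pfin finj lev1 lev2 lev_proper Pp d0.
  have Gp := ZG Zp.
  have phiP z : P z -> z <> p -> z <> p^*%C -> phi z = 1 /\ phi z^*%C = 1.
    move=> Pz zp zpc; split; first exact: phi1.
    apply: phi1; first by case: Pz => Zz; [right; rewrite conjcK | left].
    by move=> zE; apply: zpc; rewrite -zE conjcK.
  case kE : (kind p) => [I|].
    have [SI pp] := kindP Zp kE.
    exists (point_stem phi I) => _; split.
    - by split; [exact: (point_stem_hol Gconj phih) | exact: point_stem_conj].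
    - exact: (point_stem_expanding Gconj C1 CM phi0 SI).
    - by move=> z Pz zp zpc; have [] := phiP z Pz zp zpc; exact: point_stem1.
    - move=> z Kz; apply: le_trans (point_stem_near1 Gconj phiK I Kz) _.
      apply: le_trans dM; rewrite ler_pM2l // /M kE lerD2r.
      by have := anorm_ge0 (cone : AC); lra.
    - by split=> // J [<-]; exact: (point_stem_sqr Gconj Gp phi0 SI pp).
  exists (sphere_stem phi) => _; split.
  - by split; [exact: (sphere_stem_hol Gconj phih) | exact: sphere_stem_conj].
  - exact: (sphere_stem_expanding Gconj phi0).
  - by move=> z Pz zp zpc; have [] := phiP z Pz zp zpc; exact: sphere_stem1.
  - move=> z Kz; apply: le_trans (sphere_stem_near1 Gconj phiK d1 Kz) _.
    by apply: le_trans dM; rewrite /M kE addr0 mulrA [3 * d]mulrC.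
  - by split=> // _; rewrite (sphere_stem0 Gp phi0) cmul0l.
have /choice[e he] : forall n, exists e : R[i] -> AC,
    (exists p, [/\ Z p, f p = n & e = E p]) \/
    ((forall p, Z p -> f p <> n) /\ e = fun=> cone).
  move=> n; have [[p [Zp fp]]|H] := pselect (exists p, Z p /\ f p = n).
    by exists (E p); left; exists p.
  by exists (fun=> cone); right; split=> // p Zp fp; apply: H; exists p.
have [|n z|m|F [Fh Fc Finj Feq]] := infinite_sandwich Gopen Gconj C1 CM (e := e).
- move=> n j; have [[p [Zp _ ->]]|[_ ->]] := he n; last exact: hol_cst.
  by have [[h _]] := hE p Zp.
- have [[p [Zp _ ->]]|[_ ->]] := he n; last by rewrite cconj_cone.
  by have [[_ h]] := hE p Zp.
- have [N hN] := lev_proper m; exists N => n z Nn Kz.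
  have [[p [Zp fp ->]]|[_ ->]] := he n; last first.
    by rewrite subrr anorm0 mulr0 divr_ge0 ?exprn_ge0.
  have [_ _ _ h _] := hE p Zp.
  have Kz' : exhaustion G (level p) z.
    by apply: exhaustion_leq Kz; apply: hN; [left | rewrite fp].
  by have := h _ Kz'; rewrite /t ler_pdivlMr // mulrC fp.
exists F; split=> //.
- move=> z Gz Zz Zzc; apply: Finj => // n.
  have [[p [Zp _ ->]]|[_ ->]] := he n; last by exists 1 => // x; rewrite cmul1r mul1r.
  have [_ h _ _ _] := hE p Zp; apply: h => // zE; [by apply: Zz; rewrite zE|].
  by apply: Zzc; rewrite zE conjcK.
all: have Fsq z : Z z -> F z = cmul (E z z) (E z z).
1,3: move=> Zz; have [[p [Zp fp eE]]|[/(_ z Zz)//]] := he (f z);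
  have pz : p = z by apply: finj => //; left.
1,2: rewrite (Feq z (f z)) ?eE ?pz //; first exact: ZG;
  move=> k kn; have [[q [Zq fq ->]]|[_ ->]] := he k => //;
  have [_ _ h _ _] := hE q Zq; apply: h; [by left | |];
  [by move=> zq; apply: kn; rewrite -fq zq | move=> /(Z_conj_eq Zz Zq) zq; apply: kn; by rewrite -fq zq].
- by move=> z Zz kz; rewrite Fsq //; have [_ _ _ _ [h _]] := hE z Zz; exact: h.
- by move=> z I Zz kz; have [_ _ _ _ [_ h]] := hE z Zz; rewrite Fsq //; exact: h.
Qed.

End StemWithZeros.

(** * Zeros of the induced function *)

Section ZerosOfInducedFunction.
Context {R : realType} {A : altStarAlgType R}.
Implicit Types (I J : A) (c : R[i]).

Lemma cone_plus_i I : cone + 'i%C *: creal I = (aone, I).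
Proof.
rewrite /cone /creal {1}/GRing.scale /= /cscale /= !scale0r scaler0 !scale1r sub0r.
by congr (_, _) => /=; rewrite ?oppr0 ?add0r ?addr0.
Qed.

Lemma point_value_eq0 I c (u : complexification A) : pseudosphere I ->
  u = c *: (cone + 'i%C *: creal I) -> u.1 + amul I u.2 = 0.
Proof.
move=> SI ->; rewrite cone_plus_i /GRing.scale /= /cscale /=.
rewrite amulDr !amulZr pseudosphere_sqr // amul1r scalerN.
by rewrite addrACA subrr addNr addr0.
Qed.

(** If the function vanishes over [I] as well, then [(1 - i I) (1 + i J) = 0], and the
    component of this product along [i] is [J - I]. *)
Lemma point_value_inj I J c (u : complexification A) : pseudosphere I ->
    c != 0 -> u = c *: (cone + 'i%C *: creal J) -> u.1 + amul I u.2 = 0 -> I = J.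
Proof.
move=> SI c0; rewrite cone_plus_i; case: u => a b uE /(zero_divisor_of_zero SI).
rewrite uE cmulZr => /(congr1 ( *:%R c^-1)); rewrite scalerA mulVf // scale1r scaler0.
rewrite /cmul /= !amul1l amulNl !amul1r => -[_ /eqP].
by rewrite subr_eq0 => /eqP ->.
Qed.

(** A disc has infinitely many points, and it lies in some member of the exhaustion. *)
Lemma ex_notin_finite (G E : set R[i]) z : open G -> G z ->
  (forall n, finite_set (E `&` exhaustion G n)) -> exists2 p, G p & ~ E p.
Proof.
move=> Go Gz Efin; have [r r0 zG] := open_cdisc Go Gz.
have r2 : r / 2 < r by lra.
have [n Kn] := cdisc_exhaustion r2 zG; have /finite_seqP[s sE] := Efin n.
pose a k : R[i] := z + (r / 2)%:C%C * (k.+1%:R)^-1.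
have aK k : exhaustion G n (a k).
  apply: Kn; rewrite /cdisc /= /a addrC addKr cabsM cabsR cabsV cabs_nat.
  rewrite gtr0_norm ?divr_gt0 // ler_pdivrMr ?ltr0n // ler_peMr ?ler1n //.
  by rewrite ltW // divr_gt0.
have a_inj : injective a.
  move=> j k /addrI /mulfI h; have /h/invr_inj/eqP : (r / 2)%:C%C != 0 :> R[i].
    by rewrite -cabs_gt0 cabsR normr_gt0 gt_eqF // divr_gt0.
  by rewrite eqr_nat => /eqP [].
have [k sk] : exists k, a k \notin s.
  apply: contrapT => H.
  have sub : {subset [seq a k | k <- iota 0 (size s).+1] <= s}.
    by move=> _ /mapP[k _ ->]; apply: contrapT => /negP ks; apply: H; exists k.
  have := uniq_leq_size _ sub; rewrite map_inj_uniq // iota_uniq size_map size_iota ltnn.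
  by move=> /(_ isT).
exists (a k); first exact: exhaustion_sub (aK k).
move=> Ek; have : (E `&` exhaustion G n) (a k) by split.
by rewrite sE /= (negPf sk).
Qed.

End ZerosOfInducedFunction.

Unset Implicit Arguments.

Theorem theorem15p1 (R : realType) (A : altStarAlgType R) (G : set R[i])
    (D : set A) (hG : symmetric_domain G) (hD : adapted G D) :
  exists (f : A -> A) (F : R[i] -> complexification A) (p : R[i]),
    [/\ slice_regular_with_stem G F f,
        G p,
        D = [set q | axial_domain G q /\ f q = 0]
      & cinvertible (F p)].
Proof.
have [[z0 Gz0] Go Gc _] := hG; have [DG Dlim Dsph] := hD.
have Gopen z := @open_cdisc R G z Go.
pose Z := @pi_image R A D.
have Zup : Z `<=` [set z | 0 <= complex.Im z] := @pi_image_upper R A D.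
have ZG : Z `<=` G := pi_image_sub Gc DG.
have Zfin n : finite_set (Z `&` exhaustion G n) := finite_exhaustion n Zup Dlim.
(* A real point counts as a whole sphere, being its own axial sphere. *)
have /choice[kind kindE] : forall z : R[i], exists k : option A, Z z ->
    (k = None /\ axial_sphere (complex.Re z) (complex.Im z) `<=` D) \/
    exists I, [/\ k = Some I, pseudosphere I, z <> z^*%C,
      D (slice_pt (complex.Re z) (complex.Im z) I)
      & is_subset1 (axial_sphere (complex.Re z) (complex.Im z) `&` D)].
  move=> [x y]; have [Zz|] := pselect (Z (x +i* y)%C); last by exists None.
  have [full|one] := Dsph x y; first by exists None => _; left.
  have [I SI DI] := proj1 (pi_imageP D x (Zup _ Zz)) Zz.
  have [y0|y0] := eqVneq y 0.
    exists None => _; left; split=> // _ [J _ <-] /=; move: DI.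
    by rewrite /slice_pt y0 !scale0r.
  exists (Some I) => _; right; exists I; split=> // -[yE].
  by move/eqP: y0; apply; lra.
have kindP z I : Z z -> kind z = Some I -> pseudosphere I /\ z <> z^*%C.
  by move=> /kindE[[-> //]|[J [-> SJ zz _ _]]] [<-].
have [F [Fhol Fconj Finj F0 F1]] := ex_stem_with_zeros Gopen Gc ZG Zup Zfin kindP.
have /choice[f fE] : forall q : A, exists v : A, forall x y I, G (x +i* y)%C ->
    pseudosphere I -> q = slice_pt x y I -> v = (F (x +i* y)%C).1 + amul I (F (x +i* y)%C).2.
  move=> q; have [[x [y [I [Gz SI ->]]]]|H] := pselect (axial_domain G q); last first.
    by exists 0 => x y I Gz SI qE; exfalso; apply: H; exists x, y, I.
  exists ((F (x +i* y)%C).1 + amul I (F (x +i* y)%C).2) => x' y' J Gz' SJ.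
  exact: stem_value_eq.
have find : induced_by G F f by move=> x y I Gz SI; exact: fE.
have [p Gp Pp] : exists2 p, G p & ~ (Z p \/ Z p^*%C).
  apply: (ex_notin_finite (E := [set z | Z z \/ Z z^*%C]) Go Gz0) => n.
  apply: (@sub_finite_set _ _ ((Z `&` exhaustion G n) `|` (@conjc R) @` (Z `&` exhaustion G n))).
    move=> z [[Zz|Zz] Kz]; [by left | right; exists z^*%C; last by rewrite conjcK].
    by split=> //; exact: exhaustion_conj.
  by rewrite finite_setU; split=> //; exact: finite_image.
exists f, F, p; split=> //.
- split=> //; split=> // z Gz j; exact: (hol_derivable Gopen (Fhol j)).
- apply/seteqP; split=> q.
    move=> Dq; have qG := DG q Dq; split=> //.
    have [x [y [I [y0 Gz SI qE]]]] := axial_domain_upper Gc qG.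
    have Zz : Z (x +i* y)%C by apply/pi_imageP => //; exists I => //; rewrite -qE.
    rewrite qE find //.
    have [[kz _]|[J [kz SJ zz DJ one]]] := kindE _ Zz.
      by rewrite F0 //= amul0r addr0.
    have [c _ Fz] := F1 _ _ Zz kz.
    have IJ : I = J.
      apply: (@slice_pt_neq_inj _ _ x y).
        by apply/eqP => yE; apply: zz; rewrite yE /= oppr0.
      apply: one; split=> //; [by exists I | by rewrite -qE | by exists J].
    by rewrite IJ; exact: point_value_eq0 Fz.
  move=> [/(axial_domain_upper Gc)[x [y [I [y0 Gz SI ->]]]]]; rewrite find // => fz.
  have Zz : Z (x +i* y)%C.
    apply: contrapT => nZ.
    have nZc : ~ Z (x +i* y)^*%C.
      move=> Zc; have yc : 0 <= - y := Zup _ Zc.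
      have yE : y = 0 by lra.
      by apply: nZ; move: Zc; rewrite yE /= oppr0.
    move: fz; case FE : (F _) => [a b] /= /(zero_divisor_of_zero SI); rewrite -FE.
    by move=> /(Finj _ Gz nZ nZc) [/eqP]; rewrite (negPf aone_neq0).
  have [[kz full]|[J [kz SJ zz DJ one]]] := kindE _ Zz; first by apply: full; exists I.
  have [c c0 Fz] := F1 _ _ Zz kz.
  by rewrite (point_value_inj SI c0 Fz fz).
- by apply: cinvertible_of_injr; apply: Finj => // Zp; apply: Pp; [left | right].
Qed.
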